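(* Each surface with parallel normalized mean curvature vector field in the Euclidean space $\mathbb{E}^4$ locally admits canonical parameters, i.e. local parameters $(u,v)$ whose first fundamental form coefficients satisfy $$E(u,v) = \frac{1}{|\mu(u,v)|}, \qquad F(u,v) = 0, \qquad G(u,v) = \frac{1}{|\mu(u,v)|},$$ where $\mu$ is the geometric function of the surface defined in the context.
   Context: Let $M^2$ be a 2-dimensional surface in Euclidean 4-space $\mathbb{E}^4$ with metric $\langle\cdot,\cdot\rangle$. Denote by $\nabla'$ the Levi-Civita connection of $\mathbb{E}^4$, by $\nabla$ that of $M^2$, by $\sigma$ the second fundamental form, by $A_\xi$ the shape operators and by $D$ the normal connection, so that $\nabla'_X Y = \nabla_X Y + \sigma(X,Y)$ and $\nabla'_X\xi = -A_\xi X + D_X\xi$ for tangent $X,Y$ and normal $\xi$. The mean curvature vector field is $H = \frac12 \operatorname{tr}\sigma$. $M^2$ is a surface with parallel normalized mean curvature vector field if $H$ is non-zero and there exists a unit vector field $b$ in the direction of $H$ which is parallel in the normal bundle, i.e. $Db = 0$ identically. Geometric frame and functions: for a surface free of minimal points (that is, $H\neq 0$ at every point), the geometric frame field is an orthonormal frame field $\{x,y,b,l\}$ with $x,y$ tangent to $M^2$ (tangent to the so-called principal lines), $b,l$ normal to $M^2$, $b$ collinear with $H$, and $$\sigma(x,x) = \nu_1 b,\qquad \sigma(x,y) = \lambda b + \mu l,\qquad \sigma(y,y) = \nu_2 b .$$ The functions $\nu_1,\nu_2,\lambda,\mu$ are among the geometric functions of the surface; in particular $\mu = \langle\nabla'_x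 y, l\rangle$. For a parametrization $z = z(u,v)$ of $M^2$, $E = \langle z_u,z_u\rangle$, $F = \langle z_u,z_v\rangle$, $G = \langle z_v,z_v\rangle$.
   Formalization: The formal theorem additionally assumes that μ is nonzero at every point of the surface; where μ = 0 (for example a round sphere in a hyperplane E^3) the required value 1/|μ| is undefined. *)

(* Defs.v *)
From Stdlib Require Import Reals.
From Coquelicot Require Import Coquelicot.
Open Scope R_scope.

Definition E4 : Type := (R * R * R * R)%type.

Definition c1 (p : E4) : R := fst (fst (fst p)).
Definition c2 (p : E4) : R := snd (fst (fst p)).
Definition c3 (p : E4) : R := snd (fst p).
Definition c4 (p : E4) : R := snd p.

Definition dot (p q : E4) : R :=
  c1 p * c1 q + c2 p * c2 q + c3 p * c3 q + c4 p * c4 q.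

Definition add4 (p q : E4) : E4 := plus p q.
Definition sub4 (p q : E4) : E4 := minus p q.
Definition scal4 (a : R) (p : E4) : E4 := scal a p.
Definition zero4 : E4 := (0, 0, 0, 0).

(* [ex_diff_n f n u v] is Coquelicot's recursive "n times differentiable with
   continuous partial derivatives up to order n"; [U] is always open below. *)
Definition smooth (U : R * R -> Prop) (f : R -> R -> R) : Prop :=
  forall (u v : R) (n : nat), U (u, v) -> ex_diff_n f n u v.

Definition smooth4 (U : R * R -> Prop) (Y : R -> R -> E4) : Prop :=
  smooth U (fun u v => c1 (Y u v)) /\ smooth U (fun u v => c2 (Y u v)) /\
  smooth U (fun u v => c3 (Y u v)) /\ smooth U (fun u v => c4 (Y u v)).

Definition d_u (Y : R -> R -> E4) (u v : R) : E4 :=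
  (Derive (fun s => c1 (Y s v)) u, Derive (fun s => c2 (Y s v)) u,
   Derive (fun s => c3 (Y s v)) u, Derive (fun s => c4 (Y s v)) u).

Definition d_v (Y : R -> R -> E4) (u v : R) : E4 :=
  (Derive (fun t => c1 (Y u t)) v, Derive (fun t => c2 (Y u t)) v,
   Derive (fun t => c3 (Y u t)) v, Derive (fun t => c4 (Y u t)) v).

(* A smooth immersion [z] of an open set [U] of the plane. *)
Definition surface (U : R * R -> Prop) (z : R -> R -> E4) : Prop :=
  open U /\ smooth4 U z /\
  forall u v, U (u, v) ->
    forall a b : R,
      add4 (scal4 a (d_u z u v)) (scal4 b (d_v z u v)) = zero4 ->
      a = 0 /\ b = 0.

Definition coefE (z : R -> R -> E4) (u v : R) : R := dot (d_u z u v) (d_u z u v).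
Definition coefF (z : R -> R -> E4) (u v : R) : R := dot (d_u z u v) (d_v z u v).
Definition coefG (z : R -> R -> E4) (u v : R) : R := dot (d_v z u v) (d_v z u v).

Definition detI (z : R -> R -> E4) (u v : R) : R :=
  coefE z u v * coefG z u v - coefF z u v * coefF z u v.

(* A tangent vector field is given by its components [(a, b)] in the basis
   [z_u, z_v]; [push z X] is the corresponding E^4-valued field
   [a z_u + b z_v] along the surface. *)
Definition tfield : Type := R -> R -> R * R.

Definition smoothT (U : R * R -> Prop) (X : tfield) : Prop :=
  smooth U (fun u v => fst (X u v)) /\ smooth U (fun u v => snd (X u v)).

Definition push (z : R -> R -> E4) (X : tfield) (u v : R) : E4 :=
  add4 (scal4 (fst (X u v)) (d_u z u v)) (scal4 (snd (X u v)) (d_v z u v)).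

Definition coord_u : tfield := fun _ _ => (1, 0).
Definition coord_v : tfield := fun _ _ => (0, 1).

Definition is_normal_at (z : R -> R -> E4) (w : E4) (u v : R) : Prop :=
  dot w (d_u z u v) = 0 /\ dot w (d_v z u v) = 0.

(* Orthogonal projections of [w] onto the tangent plane and the normal plane;
   the coefficients of the former solve the Gram system of [z_u, z_v]. *)
Definition tan_part (z : R -> R -> E4) (u v : R) (w : E4) : E4 :=
  add4
    (scal4 ((coefG z u v * dot w (d_u z u v) - coefF z u v * dot w (d_v z u v))
            / detI z u v) (d_u z u v))
    (scal4 ((coefE z u v * dot w (d_v z u v) - coefF z u v * dot w (d_u z u v))
            / detI z u v) (d_v z u v)).

Definition nor_part (z : R -> R -> E4) (u v : R) (w : E4) : E4 :=
  sub4 w (tan_part z u v w).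

(* The flat connection of E^4: derivative of the field [Y] along the surface
   in the tangent direction [X]. *)
Definition nabla' (X : tfield) (Y : R -> R -> E4) (u v : R) : E4 :=
  add4 (scal4 (fst (X u v)) (d_u Y u v)) (scal4 (snd (X u v)) (d_v Y u v)).

(* Gauss and Weingarten formulas: sigma(X,Y) is the normal part of nabla'_X Y
   and D_X xi is the normal part of nabla'_X xi. *)
Definition sigma (z : R -> R -> E4) (X Y : tfield) (u v : R) : E4 :=
  nor_part z u v (nabla' X (push z Y) u v).

Definition normal_D (z : R -> R -> E4) (X : tfield) (xi : R -> R -> E4)
    (u v : R) : E4 :=
  nor_part z u v (nabla' X xi u v).

(* H = (1/2) tr sigma, the trace being taken with respect to the first
   fundamental form, whose inverse is (G, -F; -F, E) / (EG - F^2). *)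
Definition mean_curv (z : R -> R -> E4) (u v : R) : E4 :=
  scal4 (1 / 2)
    (scal4 (/ detI z u v)
      (add4
        (sub4 (scal4 (coefG z u v) (sigma z coord_u coord_u u v))
              (scal4 (2 * coefF z u v) (sigma z coord_u coord_v u v)))
        (scal4 (coefE z u v) (sigma z coord_v coord_v u v)))).

Definition parallel_normalized_mean_curv (U : R * R -> Prop)
    (z : R -> R -> E4) : Prop :=
  (forall u v, U (u, v) -> mean_curv z u v <> zero4) /\
  exists b : R -> R -> E4,
    smooth4 U b /\
    (forall u v, U (u, v) -> dot (b u v) (b u v) = 1) /\
    (forall u v, U (u, v) ->
       exists c : R, 0 < c /\ mean_curv z u v = scal4 c (b u v)) /\
    (forall (X : tfield) u v, U (u, v) -> normal_D z X b u v = zero4).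

Definition geom_mu (z : R -> R -> E4) (x y : tfield) (l : R -> R -> E4)
    (u v : R) : R :=
  dot (nabla' x (push z y) u v) (l u v).

Definition geometric_frame_at (z : R -> R -> E4) (x y : tfield)
    (b l : R -> R -> E4) (u v : R) : Prop :=
  (dot (push z x u v) (push z x u v) = 1 /\
   dot (push z y u v) (push z y u v) = 1 /\
   dot (push z x u v) (push z y u v) = 0) /\
  (is_normal_at z (b u v) u v /\ is_normal_at z (l u v) u v /\
   dot (b u v) (b u v) = 1 /\ dot (l u v) (l u v) = 1 /\
   dot (b u v) (l u v) = 0) /\
  (exists h : R, mean_curv z u v = scal4 h (b u v)) /\
  exists nu1 nu2 lambda : R,
    sigma z x x u v = scal4 nu1 (b u v) /\
    sigma z x y u v =
      add4 (scal4 lambda (b u v)) (scal4 (geom_mu z x y l u v) (l u v)) /\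
    sigma z y y u v = scal4 nu2 (b u v).

Definition smooth_fields (U : R * R -> Prop) (x y : tfield)
    (b l : R -> R -> E4) : Prop :=
  smoothT U x /\ smoothT U y /\ smooth4 U b /\ smooth4 U l.

Definition geometric_frame_field (U : R * R -> Prop) (z : R -> R -> E4)
    (x y : tfield) (b l : R -> R -> E4) : Prop :=
  smooth_fields U x y b l /\
  forall u v, U (u, v) -> geometric_frame_at z x y b l u v.

(* mu does not vanish at any point, so that 1/|mu| makes sense (the division of
   the reals is total). By pointwise linear algebra every point with H <> 0 has
   a geometric frame, and mu is independent of it up to sign; hence the
   condition is never vacuous. It only quantifies over frames at one point, so
   that it does not presuppose a smooth geometric frame field. *)
Definition mu_nonvanishing (U : R * R -> Prop) (z : R -> R -> E4) : Prop :=
  forall (x y : tfield) (b l : R -> R -> E4) (u v : R),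
    smooth_fields U x y b l -> U (u, v) ->
    geometric_frame_at z x y b l u v -> geom_mu z x y l u v <> 0.

(* [(f, g)] is a smooth diffeomorphism of the open set [V] onto the open set
   [W], with smooth inverse [(p, q)]; thus [(p, q)] are new local parameters on
   [W], and the surface [z] restricted to [W] becomes [reparam z f g] on [V]. *)
Definition diffeo (V W : R * R -> Prop) (f g p q : R -> R -> R) : Prop :=
  open V /\ open W /\
  smooth V f /\ smooth V g /\ smooth W p /\ smooth W q /\
  (forall s t, V (s, t) -> W (f s t, g s t)) /\
  (forall u v, W (u, v) -> V (p u v, q u v)) /\
  (forall s t, V (s, t) -> p (f s t) (g s t) = s /\ q (f s t) (g s t) = t) /\
  (forall u v, W (u, v) -> f (p u v) (q u v) = u /\ g (p u v) (q u v) = v).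

Definition reparam (z : R -> R -> E4) (f g : R -> R -> R) : R -> R -> E4 :=
  fun s t => z (f s t) (g s t).

Definition canonical_parameters (V : R * R -> Prop) (w : R -> R -> E4) : Prop :=
  exists (x y : tfield) (b l : R -> R -> E4),
    geometric_frame_field V w x y b l /\
    forall u v, V (u, v) ->
      coefE w u v = 1 / Rabs (geom_mu w x y l u v) /\
      coefF w u v = 0 /\
      coefG w u v = 1 / Rabs (geom_mu w x y l u v).

(* Main.v *)
From Stdlib Require Import ClassicalEpsilon Reals Lra Lia.
From Coquelicot Require Import Coquelicot.
Require Import Defs.
Open Scope R_scope.

(** Let [l] be the unit normal field orthogonal to [b].  The scalar form
    [h(X, Y) = <sigma(X, Y), l>] is trace-free, because [H] is a multiple of [b].
    It vanishes at no point: otherwise every orthonormal tangent frame there would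
    be geometric with [mu = 0], which is excluded.  A trace-free symmetric form on a Euclidean plane
    which is not zero has two orthogonal isotropic directions.  A unit frame
    [X, Y] along them satisfies [h(X, X) = h(Y, Y) = 0], so it is geometric, and
    after a choice of orientation [mu = h(X, Y)] is positive.  Half-angle formulas
    give a smooth choice of [X, Y] near the base point
    ([exists_asymptotic_frame]).

    Let [th1, th2] be the coframe dual to [X, Y].  Since [b] is parallel, so is
    [l], and its derivative is tangential:
      [dz = X th1 + Y th2],     [dl = - mu (Y th1 + X th2)].
    The components along [X] and [Y] of [d(dz) = 0] and [d(dl) = 0] eliminate the
    connection form and leave [dmu ^ thi + 2 mu dthi = 0] for i = 1, 2
    ([codazzi_traceless]).  This says exactly that the forms [sqrt mu thi] are
    closed.  (In complex terms, the trace-free Codazzi tensor [h] is the imaginary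
    part of a holomorphic quadratic differential, and these two forms are the real
    and imaginary parts of its square root.)

    By the Poincare lemma ([poincare_lemma]), [sqrt mu th1 = dp] and
    [sqrt mu th2 = dq] near the base point.  The forms are independent, so [(p, q)]
    are local parameters by the inverse function theorem ([inverse_function]).  In
    these parameters the metric [th1^2 + th2^2] becomes [(dp^2 + dq^2) / mu], which
    is the claim, and the coordinate lines are the lines of the frame
    ([canonical_of_asymptotic_frame]). *)

(** * Functions of two variables of class C^k on an open set *)

(** Restates in [R] an equation whose type is one of the structures built on [R],
    in which [ring] and [field] do not recognise the field of reals. *)
Ltac eqR := match goal with |- @eq _ ?a ?b => change (@eq R a b) end.

Definition pu (f : R -> R -> R) (u v : R) : R := Derive (fun s => f s v) u.
Definition pv (f : R -> R -> R) (u v : R) : R := Derive (fun t => f u t) v.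

Definition Ck (U : R * R -> Prop) (n : nat) (f : R -> R -> R) : Prop :=
  forall u v, U (u, v) -> ex_diff_n f n u v.

Lemma open_locally_2d (U : R * R -> Prop) (u v : R) :
  open U -> U (u, v) -> locally_2d (fun s t => U (s, t)) u v.
Proof.
  intros hU h; destruct (hU (u, v) h) as [e he].
  exists e; intros s t hs ht; apply he; split; assumption.
Qed.

Lemma locally_2d_open (U : R * R -> Prop) :
  (forall u v, U (u, v) -> locally_2d (fun s t => U (s, t)) u v) -> open U.
Proof.
  intros h [u v] huv; destruct (h u v huv) as [e he].
  exists e; intros [s t] [hs ht]; apply he; assumption.
Qed.

Lemma locally_2d_mono (P Q : R -> R -> Prop) (u v : R) :
  (forall s t, P s t -> Q s t) -> locally_2d P u v -> locally_2d Q u v.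
Proof. intros h [e he]; exists e; auto. Qed.

Lemma Ck_ext U n f g : open U ->
  (forall u v, U (u, v) -> f u v = g u v) -> Ck U n f -> Ck U n g.
Proof.
  intros hU e hf u v h; apply (ex_diff_n_ext_loc f); auto.
  apply (locally_2d_mono _ _ _ _ (fun s t => e s t)), open_locally_2d; auto.
Qed.

Lemma Ck_le U n m f : (m <= n)%nat -> Ck U n f -> Ck U m f.
Proof. intros hm hf u v h; apply (ex_diff_n_m n); auto. Qed.

Lemma Ck_restrict (U V : R * R -> Prop) n f :
  (forall u v, V (u, v) -> U (u, v)) -> Ck U n f -> Ck V n f.
Proof. intros h hf u v hv; auto. Qed.

Lemma Ck_pu U n f : Ck U (S n) f -> Ck U n (pu f).
Proof. intros hf u v h; apply ex_diff_n_deriv_aux1; auto. Qed.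

Lemma Ck_pv U n f : Ck U (S n) f -> Ck U n (pv f).
Proof. intros hf u v h; apply ex_diff_n_deriv_aux2; auto. Qed.

Lemma Ck_cont U n f u v : Ck U n f -> U (u, v) -> continuity_2d_pt f u v.
Proof. intros hf h; apply hf in h; destruct n; apply h. Qed.

Lemma Ck_is_u U n f u v : Ck U (S n) f -> U (u, v) ->
  is_derive (fun s => f s v) u (pu f u v).
Proof. intros hf h; destruct (hf u v h) as [_ [e _]]; exact (Derive_correct _ _ e). Qed.

Lemma Ck_is_v U n f u v : Ck U (S n) f -> U (u, v) ->
  is_derive (fun t => f u t) v (pv f u v).
Proof. intros hf h; destruct (hf u v h) as [_ [_ [e _]]]; exact (Derive_correct _ _ e). Qed.

Lemma Ck_intro U n f fu fv : open U ->
  (forall u v, U (u, v) -> continuity_2d_pt f u v) ->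
  (forall u v, U (u, v) -> is_derive (fun s => f s v) u (fu u v)) ->
  (forall u v, U (u, v) -> is_derive (fun t => f u t) v (fv u v)) ->
  Ck U n fu -> Ck U n fv -> Ck U (S n) f.
Proof.
  intros hU hc hu hv cu cv u v h; simpl; split; [auto|split; [|split; [|split]]].
  - eexists; apply hu, h.
  - eexists; apply hv, h.
  - revert u v h; apply (Ck_ext _ _ fu); auto.
    intros u v h; symmetry; apply is_derive_unique, hu, h.
  - revert u v h; apply (Ck_ext _ _ fv); auto.
    intros u v h; symmetry; apply is_derive_unique, hv, h.
Qed.

(** The chain rule along curves needs total differentiability, which the partial
    derivatives only give through their continuity. *)
Lemma C1_differentiable U f u v : open U -> Ck U 1 f -> U (u, v) ->
  differentiable_pt_lim f u v (pu f u v) (pv f u v).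
Proof.
  intros hU hf h; apply filterdiff_differentiable_pt_lim.
  apply (is_derive_filterdiff f u v (pu f)).
  - destruct (hU _ h) as [e he]; exists e; intros [s t] hst.
    eapply (Ck_is_u U 0); auto; apply he, hst.
  - eapply Ck_is_v; eauto.
  - apply continuity_2d_pt_filterlim; apply (Ck_cont U 0); auto using Ck_pu.
Qed.

Lemma continuity_of_partials U f fu fv : open U ->
  (forall u v, U (u, v) -> is_derive (fun s => f s v) u (fu u v)) ->
  (forall u v, U (u, v) -> is_derive (fun t => f u t) v (fv u v)) ->
  (forall u v, U (u, v) -> continuity_2d_pt fu u v) ->
  forall u v, U (u, v) -> continuity_2d_pt f u v.
Proof.
  intros hU hu hv hc u v h; apply differentiable_continuity_pt.
  exists (fu u v), (fv u v); apply filterdiff_differentiable_pt_lim.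
  apply (is_derive_filterdiff f u v fu).
  - destruct (hU _ h) as [e he]; exists e; intros [s t] hst.
    apply hu, he, hst.
  - apply hv, h.
  - apply continuity_2d_pt_filterlim; auto.
Qed.

(** The induction step of every stability result below: the partial derivatives of
    a sum, product, inverse, root or composite are of class C^n by the induction
    hypothesis.  Continuity of [f] comes for free from its partial derivatives. *)
Lemma Ck_of_partials U n f fu fv : open U ->
  (forall u v, U (u, v) -> is_derive (fun s => f s v) u (fu u v)) ->
  (forall u v, U (u, v) -> is_derive (fun t => f u t) v (fv u v)) ->
  Ck U n fu -> Ck U n fv -> Ck U (S n) f.
Proof.
  intros hU hu hv cu cv; apply (Ck_intro U n f fu fv); auto.
  apply (continuity_of_partials U f fu fv); auto; intros; eapply Ck_cont; eauto.
Qed.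

Lemma Ck_const U n c : Ck U n (fun _ _ => c).
Proof.
  revert c; induction n; intros c u v h; simpl; split; auto using continuity_2d_pt_const.
  split; [apply ex_derive_const|split; [apply ex_derive_const|split]].
  - apply (ex_diff_n_ext_loc (fun _ _ => 0)); [|apply IHn, h].
    apply locally_2d_forall; intros; symmetry; apply Derive_const.
  - apply (ex_diff_n_ext_loc (fun _ _ => 0)); [|apply IHn, h].
    apply locally_2d_forall; intros; symmetry; apply Derive_const.
Qed.

Lemma Ck_fst U n : open U -> Ck U n (fun u _ => u).
Proof.
  intros hU; apply (Ck_le _ (S n)); [lia|].
  apply (Ck_of_partials U n _ (fun _ _ => 1) (fun _ _ => 0)); auto using Ck_const; intros; auto_derive; auto.
Qed.

Lemma Ck_snd U n : open U -> Ck U n (fun _ v => v).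
Proof.
  intros hU; apply (Ck_le _ (S n)); [lia|].
  apply (Ck_of_partials U n _ (fun _ _ => 0) (fun _ _ => 1)); auto using Ck_const; intros; auto_derive; auto.
Qed.

Lemma Ck_plus U n f g : open U -> Ck U n f -> Ck U n g ->
  Ck U n (fun u v => f u v + g u v).
Proof.
  intros hU; revert f g; induction n; intros f g hf hg.
  - intros u v h; split; auto; apply continuity_2d_pt_plus; [apply hf|apply hg]; auto.
  - apply (Ck_of_partials U n _ (fun u v => pu f u v + pu g u v)
             (fun u v => pv f u v + pv g u v)); auto using Ck_pu, Ck_pv; intros.
    + apply @is_derive_plus; eapply Ck_is_u; eauto.
    + apply @is_derive_plus; eapply Ck_is_v; eauto.
Qed.

Lemma Ck_mult U n f g : open U -> Ck U n f -> Ck U n g ->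
  Ck U n (fun u v => f u v * g u v).
Proof.
  intros hU; revert f g; induction n; intros f g hf hg.
  - intros u v h; split; auto; apply continuity_2d_pt_mult; [apply hf|apply hg]; auto.
  - assert (lf := Ck_le _ _ n _ (Nat.le_succ_diag_r n) hf).
    assert (lg := Ck_le _ _ n _ (Nat.le_succ_diag_r n) hg).
    apply (Ck_of_partials U n _ (fun u v => pu f u v * g u v + f u v * pu g u v)
             (fun u v => pv f u v * g u v + f u v * pv g u v)); auto using Ck_pu, Ck_pv, Ck_plus; intros.
    + apply is_derive_Reals, (derivable_pt_lim_mult (fun s => f s v) (fun s => g s v));
        apply is_derive_Reals; eapply Ck_is_u; eauto.
    + apply is_derive_Reals, (derivable_pt_lim_mult (fun t => f u t) (fun t => g u t));
        apply is_derive_Reals; eapply Ck_is_v; eauto.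
Qed.

Lemma Ck_minus U n f g : open U -> Ck U n f -> Ck U n g ->
  Ck U n (fun u v => f u v - g u v).
Proof.
  intros hU hf hg; apply (Ck_ext _ _ (fun u v => f u v + -1 * g u v)); auto.
  - intros; ring.
  - auto using Ck_plus, Ck_mult, Ck_const.
Qed.

(** The induction closes because the derivative of [1 / f] is expressed by [f'] and
    [1 / f], both already known to be of class C^n. *)
Lemma Ck_inv U n f : open U -> Ck U n f ->
  (forall u v, U (u, v) -> f u v <> 0) -> Ck U n (fun u v => / f u v).
Proof.
  intros hU hf h0; revert f hf h0; induction n; intros f hf h0.
  - intros u v h; split; auto; apply continuity_2d_pt_inv; auto; apply hf; auto.
  - assert (lf := Ck_le _ _ n _ (Nat.le_succ_diag_r n) hf).
    apply (Ck_of_partials U n _ (fun u v => - 1 * pu f u v * (/ f u v * / f u v))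
       (fun u v => - 1 * pv f u v * (/ f u v * / f u v)));
      auto using Ck_pu, Ck_pv, Ck_mult, Ck_const; intros.
    + evar_last; [apply (is_derive_inv (fun s => f s v)); [eapply Ck_is_u; eauto|auto]|].
      eqR; field; auto.
    + evar_last; [apply (is_derive_inv (fun t => f u t)); [eapply Ck_is_v; eauto|auto]|].
      eqR; field; auto.
Qed.

Lemma Ck_sqrt U n f : open U -> Ck U n f ->
  (forall u v, U (u, v) -> 0 < f u v) -> Ck U n (fun u v => sqrt (f u v)).
Proof.
  intros hU hf h0; revert f hf h0; induction n; intros f hf h0.
  - intros u v h; split; auto; apply continuity_1d_2d_pt_comp; [|apply hf; auto].
    apply continuity_pt_sqrt, Rlt_le, h0, h.
  - assert (lf := Ck_le _ _ n _ (Nat.le_succ_diag_r n) hf).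
    assert (p : forall u v, U (u, v) -> 2 * sqrt (f u v) <> 0).
    { intros u v h; generalize (sqrt_lt_R0 _ (h0 u v h)); lra. }
    apply (Ck_of_partials U n _ (fun u v => pu f u v * / (2 * sqrt (f u v)))
       (fun u v => pv f u v * / (2 * sqrt (f u v))));
      auto using Ck_pu, Ck_pv, Ck_mult, Ck_inv, Ck_const; intros.
    + apply (is_derive_sqrt (fun s => f s v)); [eapply Ck_is_u; eauto|auto].
    + apply (is_derive_sqrt (fun t => f u t)); [eapply Ck_is_v; eauto|auto].
Qed.

Lemma continuity_2d_comp h f g s t :
  continuity_2d_pt h (f s t) (g s t) -> continuity_2d_pt f s t ->
  continuity_2d_pt g s t -> continuity_2d_pt (fun s t => h (f s t) (g s t)) s t.
Proof.
  intros ch cf cg e; destruct (ch e) as [d hd].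
  generalize (locally_2d_and _ _ _ _ (cf d) (cg d)); apply locally_2d_mono.
  intros a b [h1 h2]; apply hd; auto.
Qed.

Lemma is_derive_comp_2d h (f g : R -> R) s lu lv l2 l3 :
  differentiable_pt_lim h (f s) (g s) lu lv ->
  is_derive f s l2 -> is_derive g s l3 ->
  is_derive (fun s => h (f s) (g s)) s (lu * l2 + lv * l3).
Proof.
  intros; apply is_derive_Reals, derivable_pt_lim_comp_2d; auto; apply is_derive_Reals; auto.
Qed.

Lemma Ck_comp (U V : R * R -> Prop) n h f g : open U -> open V ->
  (forall s t, V (s, t) -> U (f s t, g s t)) ->
  Ck U n h -> Ck V n f -> Ck V n g -> Ck V n (fun s t => h (f s t) (g s t)).
Proof.
  intros hU hV m; revert h f g m; induction n; intros h f g m hh hf hg.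
  - intros s t i; split; auto; apply continuity_2d_comp; [apply hh|apply hf|apply hg]; auto.
  - assert (lf := Ck_le _ _ n _ (Nat.le_succ_diag_r n) hf).
    assert (lg := Ck_le _ _ n _ (Nat.le_succ_diag_r n) hg).
    apply (Ck_of_partials V n _
      (fun s t => pu h (f s t) (g s t) * pu f s t + pv h (f s t) (g s t) * pu g s t)
      (fun s t => pu h (f s t) (g s t) * pv f s t + pv h (f s t) (g s t) * pv g s t));
      auto 8 using Ck_pu, Ck_pv, Ck_mult, Ck_plus; intros u v i;
      assert (D := C1_differentiable U h _ _ hU (Ck_le U (S n) 1 h ltac:(lia) hh) (m _ _ i)).
    + apply (is_derive_comp_2d h (fun x => f x v) (fun x => g x v)); auto; eapply Ck_is_u; eauto.
    + apply (is_derive_comp_2d h (fun x => f u x) (fun x => g u x)); auto; eapply Ck_is_v; eauto.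
Qed.

Lemma smooth_Ck U f : smooth U f <-> forall n, Ck U n f.
Proof. split; [intros h n u v i|intros h u v n i]; apply h; auto. Qed.

(** * The Poincare lemma on a square *)

Definition square (u0 v0 d : R) (x : R * R) : Prop :=
  Rabs (fst x - u0) < d /\ Rabs (snd x - v0) < d.

Lemma square_open u0 v0 d : open (square u0 v0 d).
Proof.
  apply locally_2d_open; intros u v [hu hv]; simpl in *.
  assert (e0 : 0 < Rmin (d - Rabs (u - u0)) (d - Rabs (v - v0))).
  { apply Rmin_glb_lt; lra. }
  exists (mkposreal _ e0); simpl; intros s t hs ht.
  assert (h1 := Rmin_l (d - Rabs (u - u0)) (d - Rabs (v - v0))).
  assert (h2 := Rmin_r (d - Rabs (u - u0)) (d - Rabs (v - v0))).
  split; simpl.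
  - replace (s - u0) with ((s - u) + (u - u0)) by ring.
    eapply Rle_lt_trans; [apply Rabs_triang|lra].
  - replace (t - v0) with ((t - v) + (v - v0)) by ring.
    eapply Rle_lt_trans; [apply Rabs_triang|lra].
Qed.

Lemma continuity_2d_continuous_u f u v :
  continuity_2d_pt f u v -> continuous (fun s => f s v) u.
Proof.
  intros hc; apply continuity_pt_filterlim; intros e he.
  destruct (hc (mkposreal e he)) as [d hd]; exists d; split; [apply cond_pos|].
  intros x [_ hx]; apply hd; auto.
  rewrite Rminus_eq_0, Rabs_R0; apply cond_pos.
Qed.

Lemma continuity_2d_continuous_v f u v :
  continuity_2d_pt f u v -> continuous (fun t => f u t) v.
Proof.
  intros hc; apply continuity_pt_filterlim; intros e he.
  destruct (hc (mkposreal e he)) as [d hd]; exists d; split; [apply cond_pos|].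
  intros x [_ hx]; apply hd; auto.
  rewrite Rminus_eq_0, Rabs_R0; apply cond_pos.
Qed.

Lemma between_in_interval a d x y :
  Rabs (x - a) < d -> Rmin a x <= y <= Rmax a x -> Rabs (y - a) < d.
Proof.
  unfold Rmin, Rmax; destruct Rle_dec; intros hx hy; apply Rabs_def2 in hx;
    apply Rabs_def1; lra.
Qed.

Lemma locally_Rabs_lt (a x d : R) : Rabs (x - a) < d ->
  locally x (fun y => Rabs (y - a) < d).
Proof.
  intros h; exists (mkposreal _ (proj2 (Rlt_0_minus _ _) h)); intros y hy.
  change (Rabs (y - x) < d - Rabs (x - a)) in hy.
  replace (y - a) with ((y - x) + (x - a)) by ring.
  eapply Rle_lt_trans; [apply Rabs_triang|lra].
Qed.

(** The primitive is the integral of the form along the path that goes from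
    [(u0, v0)] first horizontally, then vertically.  Its [v]-derivative is [b] by the
    fundamental theorem of calculus.  Differentiation under the integral sign and
    closedness turn its [u]-derivative into [a(u, v0)] plus the integral of
    the [v]-derivative of [a], that is, [a(u, v)]. *)
Lemma poincare_lemma u0 v0 d a b : 0 < d ->
  smooth (square u0 v0 d) a -> smooth (square u0 v0 d) b ->
  (forall u v, square u0 v0 d (u, v) -> pv a u v = pu b u v) ->
  exists p, smooth (square u0 v0 d) p /\
    (forall u v, square u0 v0 d (u, v) -> is_derive (fun s => p s v) u (a u v)) /\
    (forall u v, square u0 v0 d (u, v) -> is_derive (fun t => p u t) v (b u v)).
Proof.
  intros d0 sa sb hab; rewrite smooth_Ck in sa, sb.
  set (S := square u0 v0 d) in *.
  assert (hS : open S) by apply square_open.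
  assert (c0 : forall x : R, Rabs (x - x) < d).
  { intros x; rewrite Rminus_eq_0, Rabs_R0; auto. }
  assert (inS : forall u v, Rabs (u - u0) < d -> Rabs (v - v0) < d -> S (u, v)).
  { intros u v h1 h2; split; auto. }
  assert (ia : forall u, Rabs (u - u0) < d -> ex_RInt (fun s => a s v0) u0 u).
  { intros u hu; apply (@ex_RInt_continuous R_CompleteNormedModule); intros s hs.
    apply continuity_2d_continuous_u, (Ck_cont S 0); auto.
    apply inS; auto; eapply between_in_interval; eauto. }
  assert (ib : forall u v, S (u, v) -> ex_RInt (fun t => b u t) v0 v).
  { intros u v [hu hv]; apply (@ex_RInt_continuous R_CompleteNormedModule); intros t ht.
    apply continuity_2d_continuous_v, (Ck_cont S 0); auto.
    apply inS; auto; eapply between_in_interval; eauto. }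
  exists (fun u v => RInt (fun s => a s v0) u0 u + RInt (fun t => b u t) v0 v).
  assert (du : forall u v, S (u, v) -> is_derive
    (fun s => RInt (fun s => a s v0) u0 s + RInt (fun t => b s t) v0 v) u (a u v)).
  { intros u v [hu hv]; simpl in hu, hv.
    replace (a u v) with (a u v0 + RInt (fun t => Derive (fun s => b s t) u) v0 v).
    - apply @is_derive_plus.
      + apply (is_derive_RInt (fun s => a s v0) _ u0).
        * generalize (locally_Rabs_lt _ _ _ hu); apply filter_imp; intros y hy.
          apply (@RInt_correct R_CompleteNormedModule); auto.
        * apply continuity_2d_continuous_u, (Ck_cont S 0); auto.
      + apply (is_derive_RInt_param (fun s t => b s t)).
        * generalize (locally_Rabs_lt _ _ _ hu); apply filter_imp; intros s hs t ht.
          eexists; apply (Ck_is_u S 0 b); auto.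
          apply inS; auto; eapply between_in_interval; eauto.
        * intros t ht; apply (Ck_cont S 0 (pu b)); auto using Ck_pu.
          apply inS; auto; eapply between_in_interval; eauto.
        * generalize (locally_Rabs_lt _ _ _ hu); apply filter_imp; intros y hy.
          apply ib; split; auto.
    - assert (e : is_RInt (fun t => Derive (fun s => b s t) u) v0 v (minus (a u v) (a u v0))).
      { apply (is_RInt_ext (pv a u)).
        - intros t ht; apply (hab u t), inS; auto.
          eapply between_in_interval; [eauto|lra].
        - apply (is_RInt_derive (fun t => a u t)).
          + intros t ht; apply (Ck_is_v S 0); auto.
            apply inS; auto; eapply between_in_interval; eauto.
          + intros t ht; apply continuity_2d_continuous_v, (Ck_cont S 0 (pv a)); auto using Ck_pv.
            apply inS; auto; eapply between_in_interval; eauto. }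
      rewrite (is_RInt_unique _ _ _ _ e); unfold minus, plus, opp; simpl; ring. }
  assert (dv : forall u v, S (u, v) -> is_derive
    (fun t => RInt (fun s => a s v0) u0 u + RInt (fun t => b u t) v0 t) v (b u v)).
  { intros u v [hu hv]; simpl in hu, hv.
    replace (b u v) with (0 + b u v) by ring.
    apply @is_derive_plus; [apply @is_derive_const|].
    apply (is_derive_RInt (fun t => b u t) _ v0).
    - generalize (locally_Rabs_lt _ _ _ hv); apply filter_imp; intros y hy.
      apply (@RInt_correct R_CompleteNormedModule); auto.
    - apply continuity_2d_continuous_v, (Ck_cont S 0); auto. }
  split; [|split; auto].
  apply smooth_Ck; intros n; apply (Ck_le _ (Datatypes.S n)); [lia|].
  apply (Ck_of_partials S n _ a b); auto.
Qed.

(** * The inverse function theorem in the plane *)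

(** The bounds make the map [(T1, T2)] a contraction of ratio 1/2 for the l1 norm of
    the plane, so the iterates from the origin converge geometrically. *)
Lemma contraction_fixed_point (T1 T2 : R -> R -> R) :
  (forall a b a' b', Rabs (T1 a b - T1 a' b') <= (Rabs (a - a') + Rabs (b - b')) / 4) ->
  (forall a b a' b', Rabs (T2 a b - T2 a' b') <= (Rabs (a - a') + Rabs (b - b')) / 4) ->
  exists a b, T1 a b = a /\ T2 a b = b.
Proof.
  intros h1 h2.
  set (x := fix x n := match n with O => (0, 0) | S n => (T1 (fst (x n)) (snd (x n)), T2 (fst (x n)) (snd (x n))) end).
  set (da := fun n => fst (x (S n)) - fst (x n)).
  set (db := fun n => snd (x (S n)) - snd (x n)).
  set (C := Rabs (da O) + Rabs (db O)).
  assert (bd : forall n, Rabs (da n) + Rabs (db n) <= C * (/ 2) ^ n).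
  { induction n; [simpl; unfold C; lra|].
    assert (e1 := h1 (fst (x (S n))) (snd (x (S n))) (fst (x n)) (snd (x n))).
    assert (e2 := h2 (fst (x (S n))) (snd (x (S n))) (fst (x n)) (snd (x n))).
    change (Rabs (da (S n)) <= (Rabs (da n) + Rabs (db n)) / 4) in e1.
    change (Rabs (db (S n)) <= (Rabs (da n) + Rabs (db n)) / 4) in e2.
    simpl; lra. }
  assert (g : ex_series (fun n => C * (/ 2) ^ n)).
  { apply (ex_series_scal_l C (fun n => (/ 2) ^ n)), ex_series_geom; rewrite Rabs_pos_eq; lra. }
  assert (cv : forall y : nat -> R,
     (forall n, Rabs (y (S n) - y n) <= C * (/2)^n) -> exists l : R, is_lim_seq y l).
  { intros y hy.
    destruct (ex_series_le (fun n => y (S n) - y n) _ hy g) as [l hl].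
    exists (y O + l); apply is_lim_seq_incr_1.
    apply (is_lim_seq_ext (fun n => y O + sum_n (fun n => y (S n) - y n) n)).
    - induction n; [rewrite sum_O; ring|].
      rewrite sum_Sn; unfold plus; simpl; lra.
    - apply (is_lim_seq_plus' (fun _ => y O)); [apply is_lim_seq_const|exact hl]. }
  destruct (cv (fun n => fst (x n))) as [a ha].
  { intros n; generalize (bd n) (Rabs_pos (db n)); unfold da; lra. }
  destruct (cv (fun n => snd (x n))) as [b hb].
  { intros n; generalize (bd n) (Rabs_pos (da n)); unfold db; lra. }
  assert (lim : forall T : R -> R -> R,
     (forall a b a' b', Rabs (T a b - T a' b') <= (Rabs (a - a') + Rabs (b - b')) / 4) ->
     is_lim_seq (fun n => T (fst (x n)) (snd (x n))) (T a b)).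
  { intros T hT.
    assert (z1 : is_lim_seq (fun n => Rabs (fst (x n) - a)) 0).
    { apply (is_lim_seq_abs_0 (fun n => fst (x n) - a)).
      replace 0 with (a - a) by ring.
      apply is_lim_seq_minus'; [exact ha|apply is_lim_seq_const]. }
    assert (z2 : is_lim_seq (fun n => Rabs (snd (x n) - b)) 0).
    { apply (is_lim_seq_abs_0 (fun n => snd (x n) - b)).
      replace 0 with (b - b) by ring.
      apply is_lim_seq_minus'; [exact hb|apply is_lim_seq_const]. }
    assert (z3 : is_lim_seq (fun n => Rabs (T (fst (x n)) (snd (x n)) - T a b)) 0).
    { apply (is_lim_seq_le_le (fun _ => 0) _ (fun n => (Rabs (fst (x n) - a) + Rabs (snd (x n) - b)) / 4)).
      - intros n; split; [apply Rabs_pos|apply hT].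
      - apply is_lim_seq_const.
      - replace (Finite 0) with (Finite ((0 + 0) / 4)) by (f_equal; field).
        apply is_lim_seq_mult'; [|apply is_lim_seq_const].
        apply is_lim_seq_plus'; auto. }
    apply (is_lim_seq_ext (fun n => (T (fst (x n)) (snd (x n)) - T a b) + T a b)).
    { intros n; ring. }
    replace (Finite (T a b)) with (Finite (0 + T a b)) by (f_equal; ring).
    apply is_lim_seq_plus'; [|apply is_lim_seq_const].
    apply is_lim_seq_abs_0; auto. }
  exists a, b; split.
  - apply is_lim_seq_incr_1 in ha.
    assert (e := is_lim_seq_unique _ _ (lim T1 h1)).
    assert (e' := is_lim_seq_unique _ _ ha); simpl in e'.
    rewrite e in e'; injection e'; auto.
  - apply is_lim_seq_incr_1 in hb.
    assert (e := is_lim_seq_unique _ _ (lim T2 h2)).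
    assert (e' := is_lim_seq_unique _ _ hb); simpl in e'.
    rewrite e in e'; injection e'; auto.
Qed.

(** Near a critical point both partial derivatives are below 1/4; the mean value
    theorem is applied along a horizontal and a vertical segment. *)
Lemma lipschitz_of_small_gradient U f u0 v0 : open U -> Ck U 1 f -> U (u0, v0) ->
  pu f u0 v0 = 0 -> pv f u0 v0 = 0 ->
  exists d, 0 < d /\ forall u v u' v',
    Rabs (u - u0) <= d -> Rabs (v - v0) <= d -> Rabs (u' - u0) <= d -> Rabs (v' - v0) <= d ->
    Rabs (f u v - f u' v') <= (Rabs (u - u') + Rabs (v - v')) / 4.
Proof.
  intros hU hf h0 hu hv.
  assert (q : 0 < / 4) by lra.
  destruct (Ck_cont U 0 _ _ _ (Ck_pu _ _ _ hf) h0 (mkposreal _ q)) as [d1 h1].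
  destruct (Ck_cont U 0 _ _ _ (Ck_pv _ _ _ hf) h0 (mkposreal _ q)) as [d2 h2].
  destruct (open_locally_2d _ _ _ hU h0) as [d3 h3].
  assert (m : 0 < Rmin d1 (Rmin d2 d3)).
  { repeat apply Rmin_glb_lt; apply cond_pos. }
  rewrite hu in h1; rewrite hv in h2; simpl in h1, h2.
  set (d := Rmin d1 (Rmin d2 d3) / 2).
  assert (l1 : d < d1) by (assert (i := Rmin_l d1 (Rmin d2 d3)); unfold d; lra).
  assert (l2 : d < d2).
  { assert (i := Rmin_r d1 (Rmin d2 d3)); assert (j := Rmin_l d2 d3); unfold d; lra. }
  assert (l3 : d < d3).
  { assert (i := Rmin_r d1 (Rmin d2 d3)); assert (j := Rmin_r d2 d3); unfold d; lra. }
  exists d; split; [unfold d; lra|]; intros u v u' v' bu bv bu' bv'.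
  assert (conv : forall a x y c, Rabs (x - a) <= d -> Rabs (y - a) <= d ->
    Rmin x y <= c <= Rmax x y -> Rabs (c - a) <= d).
  { intros a x y c hx hy; apply Rabs_le_between' in hx; apply Rabs_le_between' in hy.
    unfold Rmin, Rmax; destruct Rle_dec; intros hc; apply Rabs_le_between'; lra. }
  assert (inU : forall x y, Rabs (x - u0) <= d -> Rabs (y - v0) <= d -> U (x, y)).
  { intros x y hx hy; apply h3; lra. }
  destruct (MVT_gen (fun s => f s v) u' u (fun s => pu f s v)) as [c [hc ec]].
  { intros x hx; apply (Ck_is_u U 0); auto; apply inU; auto.
    apply (conv _ u' u); auto; lra. }
  { intros x hx; apply continuity_pt_filterlim, continuity_2d_continuous_u, (Ck_cont U 1); auto.
    apply inU; auto; apply (conv _ u' u); auto. }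
  destruct (MVT_gen (fun t => f u' t) v' v (fun t => pv f u' t)) as [e [he ee]].
  { intros x hx; apply (Ck_is_v U 0); auto; apply inU; auto.
    apply (conv _ v' v); auto; lra. }
  { intros x hx; apply continuity_pt_filterlim, continuity_2d_continuous_v, (Ck_cont U 1); auto.
    apply inU; auto; apply (conv _ v' v); auto. }
  assert (cu : Rabs (c - u0) <= d) by (apply (conv _ u' u); auto).
  assert (ev : Rabs (e - v0) <= d) by (apply (conv _ v' v); auto).
  replace (f u v - f u' v') with (pu f c v * (u - u') + pv f u' e * (v - v')) by lra.
  assert (b1 : Rabs (pu f c v) < / 4).
  { rewrite <- (Rminus_0_r (pu f c v)); apply h1; lra. }
  assert (b2 : Rabs (pv f u' e) < / 4).
  { rewrite <- (Rminus_0_r (pv f u' e)); apply h2; lra. }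
  eapply Rle_trans; [apply Rabs_triang|]; rewrite !Rabs_mult.
  assert (p1 := Rabs_pos (u - u')); assert (p2 := Rabs_pos (v - v')).
  nra.
Qed.

(** The retraction of the line onto the interval of centre [a] and radius [d].
    It extends a contraction defined on a square to one defined on the whole
    plane. *)
Definition clamp (a d x : R) : R := Rmax (a - d) (Rmin (a + d) x).

Lemma clamp_in a d x : 0 < d -> Rabs (clamp a d x - a) <= d.
Proof.
  intros hd; apply Rabs_le_between'; unfold clamp, Rmax, Rmin.
  repeat destruct Rle_dec; lra.
Qed.

Lemma clamp_id a d x : Rabs (x - a) < d -> clamp a d x = x.
Proof.
  intros h; apply Rabs_def2 in h; unfold clamp, Rmax, Rmin.
  repeat destruct Rle_dec; lra.
Qed.

Lemma clamp_lipschitz a d x y : Rabs (clamp a d x - clamp a d y) <= Rabs (x - y).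
Proof.
  unfold clamp, Rmax, Rmin; repeat destruct Rle_dec; unfold Rabs;
    repeat destruct Rcase_abs; lra.
Qed.

(** With [J] the Jacobian matrix at the base point and [P = (p, q)], the map
    [x - J^-1 P x] has zero differential there, so it is a contraction of some
    square, extended to the plane by [clamp].  The solutions of [P x = (s, t)] in that
    square are the fixed points of [x |-> J^-1 (s, t) + (x - J^-1 P x)].  Thanks to the
    extension, a fixed point exists for every [(s, t)], so that [f] and [g] are
    defined and Lipschitz on the whole plane, and no image of the square has to be
    estimated. *)
Lemma local_inverse U p q u0 v0 : open U -> Ck U 1 p -> Ck U 1 q -> U (u0, v0) ->
  pu p u0 v0 * pv q u0 v0 - pv p u0 v0 * pu q u0 v0 <> 0 ->
  exists d f g K, 0 < d /\ 0 < K /\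
    (forall u v, square u0 v0 d (u, v) -> U (u, v)) /\
    (forall s t s' t', Rabs (f s t - f s' t') <= K * (Rabs (s - s') + Rabs (t - t'))) /\
    (forall s t s' t', Rabs (g s t - g s' t') <= K * (Rabs (s - s') + Rabs (t - t'))) /\
    (forall s t, square u0 v0 d (f s t, g s t) ->
       p (f s t) (g s t) = s /\ q (f s t) (g s t) = t) /\
    (forall u v, square u0 v0 d (u, v) -> f (p u v) (q u v) = u /\ g (p u v) (q u v) = v).
Proof.
  intros hU hp hq h0; set (J := _ - _); intros hJ.
  set (a11 := pv q u0 v0 / J); set (a12 := - pv p u0 v0 / J).
  set (a21 := - pu q u0 v0 / J); set (a22 := pu p u0 v0 / J).
  set (F := fun u v => u - (a11 * p u v + a12 * q u v)).
  set (G := fun u v => v - (a21 * p u v + a22 * q u v)).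
  assert (cF : Ck U 1 F).
  { apply Ck_minus; auto using Ck_fst, Ck_plus, Ck_mult, Ck_const. }
  assert (cG : Ck U 1 G).
  { apply Ck_minus; auto using Ck_snd, Ck_plus, Ck_mult, Ck_const. }
  assert (pU := Ck_is_u U 0 p _ _ hp h0); assert (pV := Ck_is_v U 0 p _ _ hp h0).
  assert (qU := Ck_is_u U 0 q _ _ hq h0); assert (qV := Ck_is_v U 0 q _ _ hq h0).
  assert (zF : pu F u0 v0 = 0 /\ pv F u0 v0 = 0).
  { split; apply is_derive_unique; unfold F; auto_derive;
      try (repeat split; eexists; eassumption);
      change (Derive (fun x : R => p x v0) u0) with (pu p u0 v0);
      change (Derive (fun x : R => q x v0) u0) with (pu q u0 v0);
      change (Derive (fun x : R => p u0 x) v0) with (pv p u0 v0);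
      change (Derive (fun x : R => q u0 x) v0) with (pv q u0 v0);
      eqR; unfold a11, a12, J in *; field; auto. }
  assert (zG : pu G u0 v0 = 0 /\ pv G u0 v0 = 0).
  { split; apply is_derive_unique; unfold G; auto_derive;
      try (repeat split; eexists; eassumption);
      change (Derive (fun x : R => p x v0) u0) with (pu p u0 v0);
      change (Derive (fun x : R => q x v0) u0) with (pu q u0 v0);
      change (Derive (fun x : R => p u0 x) v0) with (pv p u0 v0);
      change (Derive (fun x : R => q u0 x) v0) with (pv q u0 v0);
      eqR; unfold a21, a22, J in *; field; auto. }
  destruct (lipschitz_of_small_gradient U F u0 v0 hU cF h0 (proj1 zF) (proj2 zF)) as [d1 [d1p LF]].
  destruct (lipschitz_of_small_gradient U G u0 v0 hU cG h0 (proj1 zG) (proj2 zG)) as [d3 [d3p LG]].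
  destruct (open_locally_2d _ _ _ hU h0) as [d2 hd2].
  set (d := Rmin d1 (Rmin d2 d3)).
  assert (d0 : 0 < d) by (repeat apply Rmin_glb_lt; auto; apply cond_pos).
  assert (dd1 : d <= d1) by apply Rmin_l.
  assert (dd2 : d <= d2) by (eapply Rle_trans; [apply Rmin_r|apply Rmin_l]).
  assert (dd3 : d <= d3) by (eapply Rle_trans; [apply Rmin_r|apply Rmin_r]).
  assert (cl : forall a x, Rabs (clamp a d x - a) <= d) by (intros; apply clamp_in, d0).
  set (F' := fun u v => F (clamp u0 d u) (clamp v0 d v)).
  set (G' := fun u v => G (clamp u0 d u) (clamp v0 d v)).
  assert (LF' : forall a b a' b', Rabs (F' a b - F' a' b') <= (Rabs (a - a') + Rabs (b - b')) / 4).
  { intros a b a' b'; unfold F'.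
    eapply Rle_trans; [apply LF; eapply Rle_trans; eauto|].
    assert (c1 := clamp_lipschitz u0 d a a'); assert (c2 := clamp_lipschitz v0 d b b'); lra. }
  assert (LG' : forall a b a' b', Rabs (G' a b - G' a' b') <= (Rabs (a - a') + Rabs (b - b')) / 4).
  { intros a b a' b'; unfold G'.
    eapply Rle_trans; [apply LG; eapply Rle_trans; eauto|].
    assert (c1 := clamp_lipschitz u0 d a a'); assert (c2 := clamp_lipschitz v0 d b b'); lra. }
  (* The fixed point equation of the parameter [st]; where the clamps are
     identities it says that [J^-1 (st - P x) = 0]. *)
  assert (fix0 : forall st : R * R, exists x : R * R,
    (a11 * fst st + a12 * snd st) + F' (fst x) (snd x) = fst x /\
    (a21 * fst st + a22 * snd st) + G' (fst x) (snd x) = snd x).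
  { intros [s t].
    destruct (contraction_fixed_point (fun u v => (a11 * s + a12 * t) + F' u v)
      (fun u v => (a21 * s + a22 * t) + G' u v)) as [a [b hab]].
    - intros a b a' b'.
      match goal with |- Rabs ?e <= _ => replace e with (F' a b - F' a' b') by ring end; auto.
    - intros a b a' b'.
      match goal with |- Rabs ?e <= _ => replace e with (G' a b - G' a' b') by ring end; auto.
    - exists (a, b); exact hab. }
  set (x := fun st => proj1_sig (constructive_indefinite_description _ (fix0 st))).
  assert (hx := fun st => proj2_sig (constructive_indefinite_description _ (fix0 st))).
  set (f := fun s t => fst (x (s, t))); set (g := fun s t => snd (x (s, t))).
  assert (hf : forall s t, (a11 * s + a12 * t) + F' (f s t) (g s t) = f s t).
  { intros s t; apply (hx (s, t)). }
  assert (hg : forall s t, (a21 * s + a22 * t) + G' (f s t) (g s t) = g s t).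
  { intros s t; apply (hx (s, t)). }
  (* The contraction half absorbs the nonlinear terms: the distance of two
     fixed points is at most twice that of the linear parts.  Applied to a point
     of the square and to the fixed point of its image, it also shows that
     the two coincide. *)
  assert (dist : forall a b a' b' s t s' t',
    a11 * s + a12 * t + F' a b = a -> a21 * s + a22 * t + G' a b = b ->
    a11 * s' + a12 * t' + F' a' b' = a' -> a21 * s' + a22 * t' + G' a' b' = b' ->
    Rabs (a - a') + Rabs (b - b') <=
      2 * (Rabs a11 + Rabs a12 + Rabs a21 + Rabs a22) * (Rabs (s - s') + Rabs (t - t'))).
  { intros a b a' b' s t s' t' e1 e2 e3 e4.
    assert (k1 := LF' a b a' b'); assert (k2 := LG' a b a' b').
    assert (i1 : Rabs (a - a') <= Rabs a11 * Rabs (s - s') + Rabs a12 * Rabs (t - t') + Rabs (F' a b - F' a' b')).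
    { replace (a - a') with (a11 * (s - s') + a12 * (t - t') + (F' a b - F' a' b')) by lra.
      rewrite <- !Rabs_mult.
      eapply Rle_trans; [apply Rabs_triang|].
      apply Rplus_le_compat_r, Rabs_triang. }
    assert (i2 : Rabs (b - b') <= Rabs a21 * Rabs (s - s') + Rabs a22 * Rabs (t - t') + Rabs (G' a b - G' a' b')).
    { replace (b - b') with (a21 * (s - s') + a22 * (t - t') + (G' a b - G' a' b')) by lra.
      rewrite <- !Rabs_mult.
      eapply Rle_trans; [apply Rabs_triang|].
      apply Rplus_le_compat_r, Rabs_triang. }
    assert (n11 := Rabs_pos a11); assert (n12 := Rabs_pos a12).
    assert (n21 := Rabs_pos a21); assert (n22 := Rabs_pos a22).
    assert (ns := Rabs_pos (s - s')); assert (nt := Rabs_pos (t - t')).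
    assert (0 <= Rabs a11 * Rabs (t - t')) by (apply Rmult_le_pos; auto).
    assert (0 <= Rabs a12 * Rabs (s - s')) by (apply Rmult_le_pos; auto).
    assert (0 <= Rabs a21 * Rabs (t - t')) by (apply Rmult_le_pos; auto).
    assert (0 <= Rabs a22 * Rabs (s - s')) by (apply Rmult_le_pos; auto).
    lra. }
  set (K := 2 * (Rabs a11 + Rabs a12 + Rabs a21 + Rabs a22)) in dist.
  assert (K0 : 0 <= K).
  { assert (n11 := Rabs_pos a11); assert (n12 := Rabs_pos a12).
    assert (n21 := Rabs_pos a21); assert (n22 := Rabs_pos a22); unfold K; lra. }
  exists d, f, g, (K + 1); split; [auto|split; [lra|split; [|split; [|split; [|split]]]]].
  - intros u v [hu hv]; simpl in hu, hv; apply hd2; lra.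
  - intros s t s' t'.
    assert (e := dist _ _ _ _ _ _ _ _ (hf s t) (hg s t) (hf s' t') (hg s' t')).
    assert (n := Rabs_pos (g s t - g s' t')).
    assert (ns := Rabs_pos (s - s')); assert (nt := Rabs_pos (t - t')); lra.
  - intros s t s' t'.
    assert (e := dist _ _ _ _ _ _ _ _ (hf s t) (hg s t) (hf s' t') (hg s' t')).
    assert (n := Rabs_pos (f s t - f s' t')).
    assert (ns := Rabs_pos (s - s')); assert (nt := Rabs_pos (t - t')); lra.
  - intros s t [hu hv]; simpl in hu, hv.
    assert (e1 := hf s t); assert (e2 := hg s t).
    unfold F', G' in e1, e2; rewrite !clamp_id in e1, e2; auto.
    unfold F, G in e1, e2.
    set (P := p (f s t) (g s t)) in *; set (Q := q (f s t) (g s t)) in *.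
    assert (e1' : a11 * (s - P) + a12 * (t - Q) = 0) by lra.
    assert (e2' : a21 * (s - P) + a22 * (t - Q) = 0) by lra.
    split.
    + cut (s - P = 0); [lra|].
      replace (s - P) with (pu p u0 v0 * (a11 * (s - P) + a12 * (t - Q))
        + pv p u0 v0 * (a21 * (s - P) + a22 * (t - Q))).
      * rewrite e1', e2'; ring.
      * unfold a11, a12, a21, a22, J in *; field; auto.
    + cut (t - Q = 0); [lra|].
      replace (t - Q) with (pu q u0 v0 * (a11 * (s - P) + a12 * (t - Q))
        + pv q u0 v0 * (a21 * (s - P) + a22 * (t - Q))).
      * rewrite e1', e2'; ring.
      * unfold a11, a12, a21, a22, J in *; field; auto.
  - intros u v [hu hv]; simpl in hu, hv.
    assert (e := dist _ _ u v _ _ (p u v) (q u v) (hf (p u v) (q u v)) (hg (p u v) (q u v))).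
    rewrite !Rminus_eq_0, Rabs_R0, Rplus_0_l, Rmult_0_r in e.
    cut (Rabs (f (p u v) (q u v) - u) + Rabs (g (p u v) (q u v) - v) <= 0).
    + intros h.
      assert (n1 := Rabs_pos (f (p u v) (q u v) - u)); assert (n2 := Rabs_pos (g (p u v) (q u v) - v)).
      split; apply Rminus_diag_uniq; apply Rabs_eq_0; lra.
    + apply e; unfold F', G', F, G; rewrite !clamp_id by auto; ring.
Qed.

Lemma is_derive_of_bound F s l :
  (forall e, 0 < e -> exists d, 0 < d /\
    forall h, Rabs h < d -> Rabs (F (s + h) - F s - l * h) <= e * Rabs h) ->
  is_derive F s l.
Proof.
  intros H; apply is_derive_Reals; intros e he.
  destruct (H (e / 2) ltac:(lra)) as [d [d0 hd]].
  exists (mkposreal d d0); intros h h0 hh.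
  replace ((F (s + h) - F s) / h - l) with ((F (s + h) - F s - l * h) / h) by (field; auto).
  unfold Rdiv; rewrite Rabs_mult, Rabs_inv by auto.
  assert (nh : 0 < Rabs h) by (apply Rabs_pos_lt; auto).
  apply (Rmult_lt_reg_r (Rabs h)); auto.
  rewrite Rmult_assoc, Rinv_l, Rmult_1_r by lra.
  assert (b := hd h hh); nra.
Qed.

(** Implicit differentiation along a curve [(F, G)] on which [p] and [q] vary
    linearly.  Because [F] and [G] are Lipschitz at [s], the first order errors of
    [p] and [q] are [o(h)]; Cramer's rule then gives the increments of [F] and [G]
    up to [o(h)]. *)
Lemma inverse_curve_derive p q F G s K a b pU pV qU qV :
  0 < K ->
  differentiable_pt_lim p (F s) (G s) pU pV ->
  differentiable_pt_lim q (F s) (G s) qU qV ->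
  (forall h, Rabs (F (s + h) - F s) <= K * Rabs h) ->
  (forall h, Rabs (G (s + h) - G s) <= K * Rabs h) ->
  (exists d, 0 < d /\ forall h, Rabs h < d ->
     p (F (s + h)) (G (s + h)) - p (F s) (G s) = a * h /\
     q (F (s + h)) (G (s + h)) - q (F s) (G s) = b * h) ->
  pU * qV - pV * qU <> 0 ->
  is_derive F s ((qV * a - pV * b) / (pU * qV - pV * qU)) /\
  is_derive G s ((pU * b - qU * a) / (pU * qV - pV * qU)).
Proof.
  intros K0 dp dq LF LG [d0 [d0p hpq]]; set (J := pU * qV - pV * qU); intros hJ.
  (* The increments of [F] and [G] are at most [K |h|], so an error of [e / K]
     relative to them is an error of [e] relative to [h]. *)
  assert (main : forall e, 0 < e -> exists d, 0 < d /\ forall h, Rabs h < d ->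
    Rabs (a * h - pU * (F (s + h) - F s) - pV * (G (s + h) - G s)) <= e * Rabs h /\
    Rabs (b * h - qU * (F (s + h) - F s) - qV * (G (s + h) - G s)) <= e * Rabs h).
  { intros e he.
    assert (eK : 0 < e / K) by (apply Rdiv_lt_0_compat; auto).
    destruct (locally_2d_and _ _ _ _ (dp (mkposreal _ eK)) (dq (mkposreal _ eK))) as [d1 hd1].
    exists (Rmin d0 (d1 / K)); split.
    { apply Rmin_glb_lt; auto; apply Rdiv_lt_0_compat; auto; apply cond_pos. }
    intros h hh.
    assert (h1 := Rlt_le_trans _ _ _ hh (Rmin_l _ _)).
    assert (h2 := Rlt_le_trans _ _ _ hh (Rmin_r _ _)).
    assert (h3 : K * Rabs h < d1).
    { apply (Rmult_lt_compat_l K) in h2; auto.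
      replace (K * (d1 / K)) with (pos d1) in h2 by (field; lra); auto. }
    destruct (hd1 (F (s + h)) (G (s + h))) as [i1 i2].
    { eapply Rle_lt_trans; [apply LF|auto]. }
    { eapply Rle_lt_trans; [apply LG|auto]. }
    destruct (hpq h h1) as [j1 j2]; rewrite j1 in i1; rewrite j2 in i2; simpl in i1, i2.
    assert (m : e / K * Rmax (Rabs (F (s + h) - F s)) (Rabs (G (s + h) - G s)) <= e * Rabs h).
    { replace (e * Rabs h) with (e / K * (K * Rabs h)) by (field; lra).
      apply Rmult_le_compat_l; [lra|]; apply Rmax_lub; auto. }
    split; eapply Rle_trans; [| eassumption | | eassumption]; eapply Rle_trans;
      [| exact i1 | | exact i2]; right; f_equal; ring. }
  assert (comb : forall (D : R -> R) c1 c2 l,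
    (forall h, D h - l * h = c1 * (a * h - pU * (F (s + h) - F s) - pV * (G (s + h) - G s)) +
       c2 * (b * h - qU * (F (s + h) - F s) - qV * (G (s + h) - G s))) ->
    forall e, 0 < e -> exists d, 0 < d /\ forall h, Rabs h < d -> Rabs (D h - l * h) <= e * Rabs h).
  { intros D c1 c2 l hD e he.
    assert (n1 := Rabs_pos c1); assert (n2 := Rabs_pos c2).
    destruct (main (e / (Rabs c1 + Rabs c2 + 1))) as [d [d1 hd]].
    { apply Rdiv_lt_0_compat; lra. }
    exists d; split; auto; intros h hh; destruct (hd h hh) as [i1 i2].
    rewrite hD; eapply Rle_trans; [apply Rabs_triang|]; rewrite !Rabs_mult.
    set (e' := e / _) in *.
    replace e with ((Rabs c1 + Rabs c2 + 1) * e') by (unfold e'; field; lra).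
    assert (0 < e') by (apply Rdiv_lt_0_compat; lra).
    apply (Rmult_le_compat_l _ _ _ n1) in i1; apply (Rmult_le_compat_l _ _ _ n2) in i2.
    assert (0 <= e' * Rabs h) by (apply Rmult_le_pos; [lra|apply Rabs_pos]); lra. }
  split; apply is_derive_of_bound.
  - apply (comb (fun h => F (s + h) - F s) (- qV / J) (pV / J)).
    intros h; unfold J in *; field; auto.
  - apply (comb (fun h => G (s + h) - G s) (qU / J) (- pU / J)).
    intros h; unfold J in *; field; auto.
Qed.

Definition jac (p q : R -> R -> R) (u v : R) : R :=
  pu p u v * pv q u v - pv p u v * pu q u v.

(** Once differentiability is known, the partial derivatives of the inverse are
    smooth functions of [p, q] composed with the inverse itself; smoothness
    follows by induction on the order. *)
Lemma inverse_function U p q u0 v0 : open U -> smooth U p -> smooth U q ->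
  U (u0, v0) -> (forall u v, U (u, v) -> jac p q u v <> 0) ->
  exists V W f g, W (u0, v0) /\ (forall u v, W (u, v) -> U (u, v)) /\
    diffeo V W f g p q /\
    (forall s t, V (s, t) ->
       pu f s t = pv q (f s t) (g s t) / jac p q (f s t) (g s t) /\
       pu g s t = - pu q (f s t) (g s t) / jac p q (f s t) (g s t) /\
       pv f s t = - pv p (f s t) (g s t) / jac p q (f s t) (g s t) /\
       pv g s t = pu p (f s t) (g s t) / jac p q (f s t) (g s t)).
Proof.
  intros hU sp sq h0 hJ; assert (sp' := sp); assert (sq' := sq).
  rewrite smooth_Ck in sp, sq.
  destruct (local_inverse U p q u0 v0 hU (sp 1%nat) (sq 1%nat) h0 (hJ _ _ h0))
    as [d [f [g [K [d0 [K0 [sub [lf [lg [inv1 inv2]]]]]]]]]].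
  set (W := square u0 v0 d) in *.
  (* The image of [W] under [(p, q)], written as a preimage: it is open because
     [f] and [g] are continuous on the whole plane. *)
  set (V := fun x : R * R => W (f (fst x) (snd x), g (fst x) (snd x))).
  assert (inv3 : forall s t, V (s, t) -> p (f s t) (g s t) = s /\ q (f s t) (g s t) = t).
  { intros s t; apply inv1. }
  assert (lip_cont : forall f, (forall s t s' t',
    Rabs (f s t - f s' t') <= K * (Rabs (s - s') + Rabs (t - t'))) ->
    forall s t, continuity_2d_pt f s t).
  { intros k hk s t e.
    assert (e0 : 0 < e / (2 * K)) by (apply Rdiv_lt_0_compat; [apply cond_pos|lra]).
    exists (mkposreal _ e0); simpl; intros s' t' h1 h2.
    eapply Rle_lt_trans; [apply hk|].
    replace (pos e) with (K * (e / (2 * K) + e / (2 * K))) by (field; lra).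
    apply Rmult_lt_compat_l; auto; lra. }
  assert (cf := lip_cont f lf); assert (cg := lip_cont g lg).
  assert (hW : open W) by apply square_open.
  assert (hV : open V).
  { apply locally_2d_open; intros s t hst.
    destruct (open_locally_2d W _ _ hW hst) as [e he].
    generalize (locally_2d_and _ _ _ _ (cf s t e) (cg s t e)); apply locally_2d_mono.
    intros a b [h1 h2]; apply he; auto. }
  assert (ders : forall s t, V (s, t) ->
    (is_derive (fun s => f s t) s (pv q (f s t) (g s t) / jac p q (f s t) (g s t)) /\
     is_derive (fun s => g s t) s (- pu q (f s t) (g s t) / jac p q (f s t) (g s t))) /\
    (is_derive (fun t => f s t) t (- pv p (f s t) (g s t) / jac p q (f s t) (g s t)) /\
     is_derive (fun t => g s t) t (pu p (f s t) (g s t) / jac p q (f s t) (g s t)))).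
  { intros s t hst.
    assert (dp := C1_differentiable U p _ _ hU (sp 1%nat) (sub _ _ hst)).
    assert (dq := C1_differentiable U q _ _ hU (sq 1%nat) (sub _ _ hst)).
    assert (nz := hJ _ _ (sub _ _ hst)).
    destruct (open_locally_2d V s t hV hst) as [e he]; split.
    - replace (pv q (f s t) (g s t)) with (pv q (f s t) (g s t) * 1 - pv p (f s t) (g s t) * 0) by ring.
      replace (- pu q (f s t) (g s t)) with (pu p (f s t) (g s t) * 0 - pu q (f s t) (g s t) * 1) by ring.
      apply (inverse_curve_derive p q (fun s => f s t) (fun s => g s t) s K); auto.
      + intros h; eapply Rle_trans; [apply lf|].
        rewrite Rminus_eq_0, Rabs_R0; replace (s + h - s) with h by ring; right; ring.
      + intros h; eapply Rle_trans; [apply lg|].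
        rewrite Rminus_eq_0, Rabs_R0; replace (s + h - s) with h by ring; right; ring.
      + exists e; split; [apply cond_pos|]; intros h hh.
        assert (i : V (s + h, t)).
        { apply he; [replace (s + h - s) with h by ring; auto|].
          rewrite Rminus_eq_0, Rabs_R0; apply cond_pos. }
        destruct (inv3 _ _ hst) as [-> ->]; destruct (inv3 _ _ i) as [-> ->]; split; ring.
    - replace (- pv p (f s t) (g s t)) with (pv q (f s t) (g s t) * 0 - pv p (f s t) (g s t) * 1) by ring.
      replace (pu p (f s t) (g s t) / jac p q (f s t) (g s t)) with
        ((pu p (f s t) (g s t) * 1 - pu q (f s t) (g s t) * 0) / jac p q (f s t) (g s t)) by (f_equal; ring).
      apply (inverse_curve_derive p q (fun t => f s t) (fun t => g s t) t K); auto.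
      + intros h; eapply Rle_trans; [apply lf|].
        rewrite Rminus_eq_0, Rabs_R0; replace (t + h - t) with h by ring; right; ring.
      + intros h; eapply Rle_trans; [apply lg|].
        rewrite Rminus_eq_0, Rabs_R0; replace (t + h - t) with h by ring; right; ring.
      + exists e; split; [apply cond_pos|]; intros h hh.
        assert (i : V (s, t + h)).
        { apply he; [rewrite Rminus_eq_0, Rabs_R0; apply cond_pos|].
          replace (t + h - t) with h by ring; auto. }
        destruct (inv3 _ _ hst) as [-> ->]; destruct (inv3 _ _ i) as [-> ->]; split; ring. }
  assert (sfg : forall n, Ck V n f /\ Ck V n g).
  { assert (cj : forall n, Ck U n (fun u v => / jac p q u v)).
    { intros n; apply Ck_inv; auto.
      apply Ck_minus; auto using Ck_mult, Ck_pu, Ck_pv. }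
    assert (cN : forall n k, Ck U n k -> Ck U n (fun u v => - k u v)).
    { intros n k hk; apply (Ck_ext _ _ (fun u v => -1 * k u v)); auto using Ck_mult, Ck_const.
      intros; ring. }
    induction n as [|n [If Ig]].
    - split; intros s t _; split; auto.
    - assert (comp : forall k, Ck U n k ->
        Ck V n (fun s t => k (f s t) (g s t) * / jac p q (f s t) (g s t))).
      { intros k hk; apply (Ck_comp U V n (fun u v => k u v * / jac p q u v)); auto using Ck_mult. }
      split.
      + apply (Ck_of_partials V n _
          (fun s t => pv q (f s t) (g s t) * / jac p q (f s t) (g s t))
          (fun s t => - pv p (f s t) (g s t) * / jac p q (f s t) (g s t)));
          auto using Ck_pv; [intros; apply ders; auto|intros; apply ders; auto|].
        apply (comp (fun u v => - pv p u v)); auto using Ck_pv.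
      + apply (Ck_of_partials V n _
          (fun s t => - pu q (f s t) (g s t) * / jac p q (f s t) (g s t))
          (fun s t => pu p (f s t) (g s t) * / jac p q (f s t) (g s t)));
          auto using Ck_pu; [intros; apply ders; auto|intros; apply ders; auto|].
        apply (comp (fun u v => - pu q u v)); auto using Ck_pu. }
  assert (c0 : W (u0, v0)).
  { split; simpl; rewrite Rminus_eq_0, Rabs_R0; auto. }
  exists V, W, f, g; repeat (split; [now auto|]); split.
  - refine (conj hV (conj hW (conj _ (conj _ (conj _ (conj _ (conj _ (conj _ (conj inv3 inv2))))))))).
    + apply smooth_Ck; intros n; apply sfg.
    + apply smooth_Ck; intros n; apply sfg.
    + intros u v n h; apply sp'; auto.
    + intros u v n h; apply sq'; auto.
    + intros s t h; exact h.
    + intros u v h; unfold V; simpl; destruct (inv2 _ _ h) as [-> ->]; auto.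
  - intros s t h; destruct (ders s t h) as [[e1 e2] [e3 e4]].
    repeat split; apply is_derive_unique; auto.
Qed.

(** * Orthonormal frames of the Euclidean 4-space *)

Lemma E4_ext p q : c1 p = c1 q -> c2 p = c2 q -> c3 p = c3 q -> c4 p = c4 q -> p = q.
Proof.
  destruct p as [[[]]], q as [[[]]]; unfold c1, c2, c3, c4; simpl.
  intros; congruence.
Qed.

Lemma dot_sym p q : dot p q = dot q p.
Proof. unfold dot; ring. Qed.

Lemma dot_addl p q r : dot (add4 p q) r = dot p r + dot q r.
Proof. unfold dot, add4, c1, c2, c3, c4; cbn; unfold plus; simpl; ring. Qed.

Lemma dot_subl p q r : dot (sub4 p q) r = dot p r - dot q r.
Proof. unfold dot, sub4, c1, c2, c3, c4; cbn; unfold minus, plus, opp; simpl; ring. Qed.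

Lemma dot_scall a p r : dot (scal4 a p) r = a * dot p r.
Proof. unfold dot, scal4, c1, c2, c3, c4; cbn; unfold scal, mult; simpl; ring. Qed.

Lemma dot_addr p q r : dot r (add4 p q) = dot r p + dot r q.
Proof. rewrite !(dot_sym r); apply dot_addl. Qed.

Lemma dot_subr p q r : dot r (sub4 p q) = dot r p - dot r q.
Proof. rewrite !(dot_sym r); apply dot_subl. Qed.

Lemma dot_scalr a p r : dot r (scal4 a p) = a * dot r p.
Proof. rewrite !(dot_sym r); apply dot_scall. Qed.

Lemma dot_zero r : dot zero4 r = 0.
Proof. unfold dot, zero4, c1, c2, c3, c4; simpl; ring. Qed.

Ltac dots := repeat first [rewrite dot_addl | rewrite dot_subl | rewrite dot_scall
  | rewrite dot_addr | rewrite dot_subr | rewrite dot_scalr | rewrite dot_zero].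

Lemma dot_self_eq0 p : dot p p = 0 -> p = zero4.
Proof.
  unfold dot; intros h; apply E4_ext;
    [change (c1 p = 0)|change (c2 p = 0)|change (c3 p = 0)|change (c4 p = 0)]; nra.
Qed.

Lemma dot_self_ge0 p : 0 <= dot p p.
Proof. unfold dot; nra. Qed.

Lemma sub4_eq0 p q : sub4 p q = zero4 -> p = q.
Proof.
  intros e; apply E4_ext.
  - assert (h : c1 (sub4 p q) = 0) by (rewrite e; reflexivity); change (c1 p - c1 q = 0) in h; lra.
  - assert (h : c2 (sub4 p q) = 0) by (rewrite e; reflexivity); change (c2 p - c2 q = 0) in h; lra.
  - assert (h : c3 (sub4 p q) = 0) by (rewrite e; reflexivity); change (c3 p - c3 q = 0) in h; lra.
  - assert (h : c4 (sub4 p q) = 0) by (rewrite e; reflexivity); change (c4 p - c4 q = 0) in h; lra.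
Qed.

Definition det3 (a1 a2 a3 b1 b2 b3 d1 d2 d3 : R) : R :=
  a1 * (b2 * d3 - b3 * d2) - a2 * (b1 * d3 - b3 * d1) + a3 * (b1 * d2 - b2 * d1).

(** The triple vector product of the Euclidean 4-space: the coordinates are the
    cofactors of the first row of a determinant whose other rows are [p, q, r]. *)
Definition cross (p q r : E4) : E4 :=
  (det3 (c2 p) (c3 p) (c4 p) (c2 q) (c3 q) (c4 q) (c2 r) (c3 r) (c4 r),
   - det3 (c1 p) (c3 p) (c4 p) (c1 q) (c3 q) (c4 q) (c1 r) (c3 r) (c4 r),
   det3 (c1 p) (c2 p) (c4 p) (c1 q) (c2 q) (c4 q) (c1 r) (c2 r) (c4 r),
   - det3 (c1 p) (c2 p) (c3 p) (c1 q) (c2 q) (c3 q) (c1 r) (c2 r) (c3 r)).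

Lemma cross_orth p q r : dot (cross p q r) p = 0 /\ dot (cross p q r) q = 0 /\ dot (cross p q r) r = 0.
Proof.
  unfold dot, cross, det3, c1, c2, c3, c4; simpl; repeat split; ring.
Qed.

Lemma cross_norm p q r : dot (cross p q r) (cross p q r) =
  det3 (dot p p) (dot p q) (dot p r) (dot q p) (dot q q) (dot q r) (dot r p) (dot r q) (dot r r).
Proof.
  destruct p as [[[p1 p2] p3] p4], q as [[[q1 q2] q3] q4], r as [[[r1 r2] r3] r4].
  unfold dot, cross, det3, c1, c2, c3, c4; simpl; ring.
Qed.

(** Up to sign, [dot (cross p q r) s] is the determinant with rows [p, q, r, s]; the
    right side is the determinant of their Gram matrix, expanded along the first row. *)
Lemma det_sq p q r s : dot (cross p q r) s * dot (cross p q r) s =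
  dot p p * det3 (dot q q) (dot q r) (dot q s) (dot q r) (dot r r) (dot r s) (dot q s) (dot r s) (dot s s)
  - dot p q * det3 (dot p q) (dot q r) (dot q s) (dot p r) (dot r r) (dot r s) (dot p s) (dot r s) (dot s s)
  + dot p r * det3 (dot p q) (dot q q) (dot q s) (dot p r) (dot q r) (dot r s) (dot p s) (dot q s) (dot s s)
  - dot p s * det3 (dot p q) (dot q q) (dot q r) (dot p r) (dot q r) (dot r r) (dot p s) (dot q s) (dot r s).
Proof.
  destruct p as [[[p1 p2] p3] p4], q as [[[q1 q2] q3] q4],
    r as [[[r1 r2] r3] r4], s as [[[s1 s2] s3] s4].
  unfold dot, cross, det3, c1, c2, c3, c4; simpl.
  ring.
Qed.

Definition orthonormal (X Y b l : E4) : Prop :=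
  (dot X X = 1 /\ dot Y Y = 1 /\ dot b b = 1 /\ dot l l = 1) /\
  (dot X Y = 0 /\ dot X b = 0 /\ dot X l = 0) /\
  (dot Y b = 0 /\ dot Y l = 0 /\ dot b l = 0).

(** By Cramer's rule, the determinant of the frame times any coordinate of [w] is a
    combination of the four scalar products; the determinant is nonzero because
    its square is the Gram determinant, here 1. *)
Lemma orthonormal_complete X Y b l w : orthonormal X Y b l ->
  dot w X = 0 -> dot w Y = 0 -> dot w b = 0 -> dot w l = 0 -> w = zero4.
Proof.
  intros [[xx [yy [bb ll]]] [[xy [xb xl]] [yb [yl bl]]]] wx wy wb wl.
  set (D := dot (cross X Y b) l).
  assert (e : forall k, k = c1 w \/ k = c2 w \/ k = c3 w \/ k = c4 w -> D * k = 0).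
  { intros k hk.
    destruct X as [[[x1 x2] x3] x4], Y as [[[y1 y2] y3] y4], b as [[[b1 b2] b3] b4],
      l as [[[l1 l2] l3] l4], w as [[[w1 w2] w3] w4].
    unfold D, cross; unfold dot, c1, c2, c3, c4 in *; simpl in *.
    destruct hk as [->|[->|[->| ->]]].
    - transitivity (
       det3 y2 y3 y4 b2 b3 b4 l2 l3 l4 * (w1*x1+w2*x2+w3*x3+w4*x4) * (-1) +
       det3 x2 x3 x4 b2 b3 b4 l2 l3 l4 * (w1*y1+w2*y2+w3*y3+w4*y4) -
       det3 x2 x3 x4 y2 y3 y4 l2 l3 l4 * (w1*b1+w2*b2+w3*b3+w4*b4) +
       det3 x2 x3 x4 y2 y3 y4 b2 b3 b4 * (w1*l1+w2*l2+w3*l3+w4*l4));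
      [unfold det3; ring|rewrite wx, wy, wb, wl; ring].
    - transitivity (
       (det3 y1 y3 y4 b1 b3 b4 l1 l3 l4 * (w1*x1+w2*x2+w3*x3+w4*x4) -
       det3 x1 x3 x4 b1 b3 b4 l1 l3 l4 * (w1*y1+w2*y2+w3*y3+w4*y4) +
       det3 x1 x3 x4 y1 y3 y4 l1 l3 l4 * (w1*b1+w2*b2+w3*b3+w4*b4) -
       det3 x1 x3 x4 y1 y3 y4 b1 b3 b4 * (w1*l1+w2*l2+w3*l3+w4*l4)));
      [unfold det3; ring|rewrite wx, wy, wb, wl; ring].
    - transitivity (
       - (det3 y1 y2 y4 b1 b2 b4 l1 l2 l4 * (w1*x1+w2*x2+w3*x3+w4*x4) -
       det3 x1 x2 x4 b1 b2 b4 l1 l2 l4 * (w1*y1+w2*y2+w3*y3+w4*y4) +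
       det3 x1 x2 x4 y1 y2 y4 l1 l2 l4 * (w1*b1+w2*b2+w3*b3+w4*b4) -
       det3 x1 x2 x4 y1 y2 y4 b1 b2 b4 * (w1*l1+w2*l2+w3*l3+w4*l4)));
      [unfold det3; ring|rewrite wx, wy, wb, wl; ring].
    - transitivity (
       (det3 y1 y2 y3 b1 b2 b3 l1 l2 l3 * (w1*x1+w2*x2+w3*x3+w4*x4) -
       det3 x1 x2 x3 b1 b2 b3 l1 l2 l3 * (w1*y1+w2*y2+w3*y3+w4*y4) +
       det3 x1 x2 x3 y1 y2 y3 l1 l2 l3 * (w1*b1+w2*b2+w3*b3+w4*b4) -
       det3 x1 x2 x3 y1 y2 y3 b1 b2 b3 * (w1*l1+w2*l2+w3*l3+w4*l4)));
      [unfold det3; ring|rewrite wx, wy, wb, wl; ring]. }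
  assert (nD : D <> 0).
  { intros h; assert (g := det_sq X Y b l); fold D in g.
    rewrite h, xx, yy, bb, ll, xy, xb, xl, yb, yl, bl in g; unfold det3 in g; lra. }
  apply E4_ext; [change (c1 w = 0)|change (c2 w = 0)|change (c3 w = 0)|change (c4 w = 0)];
    apply (Rmult_eq_reg_l D); auto; rewrite Rmult_0_r; apply e; auto.
Qed.

Lemma orthonormal_expand X Y b l w : orthonormal X Y b l ->
  w = add4 (add4 (scal4 (dot w X) X) (scal4 (dot w Y) Y))
           (add4 (scal4 (dot w b) b) (scal4 (dot w l) l)).
Proof.
  intros h; apply sub4_eq0, (orthonormal_complete X Y b l); auto;
  destruct h as [[xx [yy [bb ll]]] [[xy [xb xl]] [yb [yl bl]]]]; dots;
  rewrite ?(dot_sym Y X), ?(dot_sym b X), ?(dot_sym l X), ?(dot_sym b Y), ?(dot_sym l Y), ?(dot_sym l b);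
  rewrite ?xx, ?yy, ?bb, ?ll, ?xy, ?xb, ?xl, ?yb, ?yl, ?bl; ring.
Qed.

(** * Smooth functions and smooth vector fields along a surface *)

Lemma smooth_is_u U f u v : smooth U f -> U (u, v) -> is_derive (fun s => f s v) u (pu f u v).
Proof. intros h; apply (Ck_is_u U 0); apply smooth_Ck, h. Qed.

Lemma smooth_is_v U f u v : smooth U f -> U (u, v) -> is_derive (fun t => f u t) v (pv f u v).
Proof. intros h; apply (Ck_is_v U 0); apply smooth_Ck, h. Qed.

Lemma smooth_cont U f u v : smooth U f -> U (u, v) -> continuity_2d_pt f u v.
Proof. intros h; apply (Ck_cont U 0); apply smooth_Ck, h. Qed.

Lemma smooth_pu U f : smooth U f -> smooth U (pu f).
Proof. rewrite !smooth_Ck; auto using Ck_pu. Qed.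

Lemma smooth_pv U f : smooth U f -> smooth U (pv f).
Proof. rewrite !smooth_Ck; auto using Ck_pv. Qed.

Lemma smooth_const U c : smooth U (fun _ _ => c).
Proof. rewrite !smooth_Ck; auto using Ck_const. Qed.

Lemma smooth_ext U f g : open U -> (forall u v, U (u, v) -> f u v = g u v) ->
  smooth U f -> smooth U g.
Proof. rewrite !smooth_Ck; eauto using Ck_ext. Qed.

Lemma smooth_restrict (U V : R * R -> Prop) f : (forall u v, V (u, v) -> U (u, v)) ->
  smooth U f -> smooth V f.
Proof. rewrite !smooth_Ck; eauto using Ck_restrict. Qed.

Lemma smooth_plus U f g : open U -> smooth U f -> smooth U g -> smooth U (fun u v => f u v + g u v).
Proof. rewrite !smooth_Ck; auto using Ck_plus. Qed.

Lemma smooth_minus U f g : open U -> smooth U f -> smooth U g -> smooth U (fun u v => f u v - g u v).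
Proof. rewrite !smooth_Ck; auto using Ck_minus. Qed.

Lemma smooth_mult U f g : open U -> smooth U f -> smooth U g -> smooth U (fun u v => f u v * g u v).
Proof. rewrite !smooth_Ck; auto using Ck_mult. Qed.

Lemma smooth_opp U f : open U -> smooth U f -> smooth U (fun u v => - f u v).
Proof.
  intros hU hf; apply (smooth_ext _ (fun u v => -1 * f u v)); auto; [intros; ring|].
  auto using smooth_mult, smooth_const.
Qed.

Lemma smooth_inv U f : open U -> smooth U f -> (forall u v, U (u, v) -> f u v <> 0) ->
  smooth U (fun u v => / f u v).
Proof. rewrite !smooth_Ck; auto using Ck_inv. Qed.

Lemma smooth_div U f g : open U -> smooth U f -> smooth U g ->
  (forall u v, U (u, v) -> g u v <> 0) -> smooth U (fun u v => f u v / g u v).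
Proof. intros; apply smooth_mult; auto using smooth_inv. Qed.

Lemma smooth_sqrt U f : open U -> smooth U f -> (forall u v, U (u, v) -> 0 < f u v) ->
  smooth U (fun u v => sqrt (f u v)).
Proof. rewrite !smooth_Ck; auto using Ck_sqrt. Qed.

Lemma smooth_comp (U V : R * R -> Prop) h f g : open U -> open V ->
  (forall s t, V (s, t) -> U (f s t, g s t)) ->
  smooth U h -> smooth V f -> smooth V g -> smooth V (fun s t => h (f s t) (g s t)).
Proof. rewrite !smooth_Ck; eauto using Ck_comp. Qed.

Lemma pu_mult U f g u v : smooth U f -> smooth U g -> U (u, v) ->
  pu (fun u v => f u v * g u v) u v = pu f u v * g u v + f u v * pu g u v.
Proof.
  intros hf hg h; apply is_derive_unique, is_derive_Reals,
    (derivable_pt_lim_mult (fun s => f s v) (fun s => g s v)); apply is_derive_Reals;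
    eapply smooth_is_u; eauto.
Qed.

Lemma pv_mult U f g u v : smooth U f -> smooth U g -> U (u, v) ->
  pv (fun u v => f u v * g u v) u v = pv f u v * g u v + f u v * pv g u v.
Proof.
  intros hf hg h; apply is_derive_unique, is_derive_Reals,
    (derivable_pt_lim_mult (fun t => f u t) (fun t => g u t)); apply is_derive_Reals;
    eapply smooth_is_v; eauto.
Qed.

Lemma pu_plus U f g u v : smooth U f -> smooth U g -> U (u, v) ->
  pu (fun u v => f u v + g u v) u v = pu f u v + pu g u v.
Proof.
  intros hf hg h; apply is_derive_unique, @is_derive_plus; eapply smooth_is_u; eauto.
Qed.

Lemma pv_plus U f g u v : smooth U f -> smooth U g -> U (u, v) ->
  pv (fun u v => f u v + g u v) u v = pv f u v + pv g u v.
Proof.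
  intros hf hg h; apply is_derive_unique, @is_derive_plus; eapply smooth_is_v; eauto.
Qed.

Lemma pu_ext U f g u v : open U -> (forall u v, U (u, v) -> f u v = g u v) -> U (u, v) ->
  pu f u v = pu g u v.
Proof.
  intros hU e h; apply Derive_ext_loc.
  apply (locally_2d_1d_const_y (fun u v => f u v = g u v)).
  apply (locally_2d_mono _ _ _ _ (fun s t => e s t)), open_locally_2d; auto.
Qed.

Lemma pv_ext U f g u v : open U -> (forall u v, U (u, v) -> f u v = g u v) -> U (u, v) ->
  pv f u v = pv g u v.
Proof.
  intros hU e h; apply Derive_ext_loc.
  apply (locally_2d_1d_const_x (fun u v => f u v = g u v)).
  apply (locally_2d_mono _ _ _ _ (fun s t => e s t)), open_locally_2d; auto.
Qed.

Lemma pu_comp (U V : R * R -> Prop) h f g s t : open U ->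
  (forall s t, V (s, t) -> U (f s t, g s t)) ->
  smooth U h -> smooth V f -> smooth V g -> V (s, t) ->
  pu (fun s t => h (f s t) (g s t)) s t =
    pu f s t * pu h (f s t) (g s t) + pu g s t * pv h (f s t) (g s t).
Proof.
  intros hU m hh hf hg i; rewrite !(Rmult_comm (pu _ s t)); apply is_derive_unique.
  apply (is_derive_comp_2d h (fun x => f x t) (fun x => g x t)); try (eapply smooth_is_u; eauto).
  apply (C1_differentiable U); auto; apply smooth_Ck, hh.
Qed.

Lemma pv_comp (U V : R * R -> Prop) h f g s t : open U ->
  (forall s t, V (s, t) -> U (f s t, g s t)) ->
  smooth U h -> smooth V f -> smooth V g -> V (s, t) ->
  pv (fun s t => h (f s t) (g s t)) s t =
    pv f s t * pu h (f s t) (g s t) + pv g s t * pv h (f s t) (g s t).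
Proof.
  intros hU m hh hf hg i; rewrite !(Rmult_comm (pv _ s t)); apply is_derive_unique.
  apply (is_derive_comp_2d h (fun x => f s x) (fun x => g s x)); try (eapply smooth_is_v; eauto).
  apply (C1_differentiable U); auto; apply smooth_Ck, hh.
Qed.

Lemma pu_pv U f u v : open U -> smooth U f -> U (u, v) -> pu (pv f) u v = pv (pu f) u v.
Proof.
  intros hU hf h; apply Schwarz.
  - apply (locally_2d_mono (fun s t => U (s, t))); [|apply open_locally_2d; auto].
    intros s t i; repeat split; eexists.
    + eapply smooth_is_u; eauto.
    + eapply smooth_is_v; eauto.
    + apply (smooth_is_u U (pv f)); auto using smooth_pv.
    + apply (smooth_is_v U (pu f)); auto using smooth_pu.
  - apply (smooth_cont U (pu (pv f))); auto using smooth_pu, smooth_pv.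
  - apply (smooth_cont U (pv (pu f))); auto using smooth_pu, smooth_pv.
Qed.

Lemma smooth4_d_u U Y : smooth4 U Y -> smooth4 U (d_u Y).
Proof. intros [h1 [h2 [h3 h4]]]; repeat apply conj; apply smooth_pu; auto. Qed.

Lemma smooth4_d_v U Y : smooth4 U Y -> smooth4 U (d_v Y).
Proof. intros [h1 [h2 [h3 h4]]]; repeat apply conj; apply smooth_pv; auto. Qed.

Lemma smooth4_restrict (U V : R * R -> Prop) Y : (forall u v, V (u, v) -> U (u, v)) ->
  smooth4 U Y -> smooth4 V Y.
Proof. intros h [h1 [h2 [h3 h4]]]; repeat apply conj; eapply smooth_restrict; eauto. Qed.

Lemma smooth_dot U P Q : open U -> smooth4 U P -> smooth4 U Q ->
  smooth U (fun u v => dot (P u v) (Q u v)).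
Proof.
  intros hU [p1 [p2 [p3 p4]]] [q1 [q2 [q3 q4]]]; unfold dot.
  repeat apply smooth_plus; auto; apply smooth_mult; auto.
Qed.

Lemma smooth4_add U P Q : open U -> smooth4 U P -> smooth4 U Q ->
  smooth4 U (fun u v => add4 (P u v) (Q u v)).
Proof.
  intros hU [p1 [p2 [p3 p4]]] [q1 [q2 [q3 q4]]]; repeat apply conj.
  - apply (smooth_plus U _ _ hU p1 q1).
  - apply (smooth_plus U _ _ hU p2 q2).
  - apply (smooth_plus U _ _ hU p3 q3).
  - apply (smooth_plus U _ _ hU p4 q4).
Qed.

Lemma smooth4_scal U f P : open U -> smooth U f -> smooth4 U P ->
  smooth4 U (fun u v => scal4 (f u v) (P u v)).
Proof.
  intros hU hf [p1 [p2 [p3 p4]]]; repeat apply conj.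
  - apply (smooth_mult U _ _ hU hf p1).
  - apply (smooth_mult U _ _ hU hf p2).
  - apply (smooth_mult U _ _ hU hf p3).
  - apply (smooth_mult U _ _ hU hf p4).
Qed.

Lemma smooth4_cross U P Q S : open U -> smooth4 U P -> smooth4 U Q -> smooth4 U S ->
  smooth4 U (fun u v => cross (P u v) (Q u v) (S u v)).
Proof.
  intros hU [p1 [p2 [p3 p4]]] [q1 [q2 [q3 q4]]] [s1 [s2 [s3 s4]]].
  unfold cross, det3; repeat apply conj; unfold c1 at 1, c2 at 1, c3 at 1, c4 at 1; simpl;
    auto 12 using smooth_plus, smooth_minus, smooth_mult, smooth_opp.
Qed.

Lemma smooth4_comp (U V : R * R -> Prop) P f g : open U -> open V ->
  (forall s t, V (s, t) -> U (f s t, g s t)) ->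
  smooth4 U P -> smooth V f -> smooth V g -> smooth4 V (fun s t => P (f s t) (g s t)).
Proof.
  intros hU hV m [p1 [p2 [p3 p4]]] hf hg; repeat apply conj.
  - apply (smooth_comp U V _ f g hU hV m p1 hf hg).
  - apply (smooth_comp U V _ f g hU hV m p2 hf hg).
  - apply (smooth_comp U V _ f g hU hV m p3 hf hg).
  - apply (smooth_comp U V _ f g hU hV m p4 hf hg).
Qed.

Lemma pu_dot U P Q u v : open U -> smooth4 U P -> smooth4 U Q -> U (u, v) ->
  pu (fun u v => dot (P u v) (Q u v)) u v = dot (d_u P u v) (Q u v) + dot (P u v) (d_u Q u v).
Proof.
  intros hU [p1 [p2 [p3 p4]]] [q1 [q2 [q3 q4]]] h; unfold dot.
  rewrite !(pu_plus U), !(pu_mult U) by auto 6 using smooth_plus, smooth_mult.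
  unfold d_u, pu; simpl; unfold c1, c2, c3, c4; simpl; ring.
Qed.

Lemma pv_dot U P Q u v : open U -> smooth4 U P -> smooth4 U Q -> U (u, v) ->
  pv (fun u v => dot (P u v) (Q u v)) u v = dot (d_v P u v) (Q u v) + dot (P u v) (d_v Q u v).
Proof.
  intros hU [p1 [p2 [p3 p4]]] [q1 [q2 [q3 q4]]] h; unfold dot.
  rewrite !(pv_plus U), !(pv_mult U) by auto 6 using smooth_plus, smooth_mult.
  unfold d_v, pv; simpl; unfold c1, c2, c3, c4; simpl; ring.
Qed.

Lemma d_u_add U P Q u v : smooth4 U P -> smooth4 U Q -> U (u, v) ->
  d_u (fun u v => add4 (P u v) (Q u v)) u v = add4 (d_u P u v) (d_u Q u v).
Proof.
  intros [p1 [p2 [p3 p4]]] [q1 [q2 [q3 q4]]] h; apply E4_ext.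
  - apply (pu_plus U _ _ u v p1 q1 h).
  - apply (pu_plus U _ _ u v p2 q2 h).
  - apply (pu_plus U _ _ u v p3 q3 h).
  - apply (pu_plus U _ _ u v p4 q4 h).
Qed.

Lemma d_v_add U P Q u v : smooth4 U P -> smooth4 U Q -> U (u, v) ->
  d_v (fun u v => add4 (P u v) (Q u v)) u v = add4 (d_v P u v) (d_v Q u v).
Proof.
  intros [p1 [p2 [p3 p4]]] [q1 [q2 [q3 q4]]] h; apply E4_ext.
  - apply (pv_plus U _ _ u v p1 q1 h).
  - apply (pv_plus U _ _ u v p2 q2 h).
  - apply (pv_plus U _ _ u v p3 q3 h).
  - apply (pv_plus U _ _ u v p4 q4 h).
Qed.

Lemma d_u_scal U f P u v : smooth U f -> smooth4 U P -> U (u, v) ->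
  d_u (fun u v => scal4 (f u v) (P u v)) u v =
    add4 (scal4 (pu f u v) (P u v)) (scal4 (f u v) (d_u P u v)).
Proof.
  intros hf [p1 [p2 [p3 p4]]] h; apply E4_ext.
  - apply (pu_mult U _ _ u v hf p1 h).
  - apply (pu_mult U _ _ u v hf p2 h).
  - apply (pu_mult U _ _ u v hf p3 h).
  - apply (pu_mult U _ _ u v hf p4 h).
Qed.

Lemma d_v_scal U f P u v : smooth U f -> smooth4 U P -> U (u, v) ->
  d_v (fun u v => scal4 (f u v) (P u v)) u v =
    add4 (scal4 (pv f u v) (P u v)) (scal4 (f u v) (d_v P u v)).
Proof.
  intros hf [p1 [p2 [p3 p4]]] h; apply E4_ext.
  - apply (pv_mult U _ _ u v hf p1 h).
  - apply (pv_mult U _ _ u v hf p2 h).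
  - apply (pv_mult U _ _ u v hf p3 h).
  - apply (pv_mult U _ _ u v hf p4 h).
Qed.

Lemma d_u_d_v U P u v : open U -> smooth4 U P -> U (u, v) -> d_u (d_v P) u v = d_v (d_u P) u v.
Proof.
  intros hU [p1 [p2 [p3 p4]]] h; apply E4_ext.
  - apply (pu_pv U _ u v hU p1 h).
  - apply (pu_pv U _ u v hU p2 h).
  - apply (pu_pv U _ u v hU p3 h).
  - apply (pu_pv U _ u v hU p4 h).
Qed.

Lemma d_u_comp (U V : R * R -> Prop) P f g s t : open U ->
  (forall s t, V (s, t) -> U (f s t, g s t)) ->
  smooth4 U P -> smooth V f -> smooth V g -> V (s, t) ->
  d_u (fun s t => P (f s t) (g s t)) s t =
    add4 (scal4 (pu f s t) (d_u P (f s t) (g s t))) (scal4 (pu g s t) (d_v P (f s t) (g s t))).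
Proof.
  intros hU m [p1 [p2 [p3 p4]]] hf hg i; apply E4_ext.
  - apply (pu_comp U V _ f g s t hU m p1 hf hg i).
  - apply (pu_comp U V _ f g s t hU m p2 hf hg i).
  - apply (pu_comp U V _ f g s t hU m p3 hf hg i).
  - apply (pu_comp U V _ f g s t hU m p4 hf hg i).
Qed.

Lemma d_v_comp (U V : R * R -> Prop) P f g s t : open U ->
  (forall s t, V (s, t) -> U (f s t, g s t)) ->
  smooth4 U P -> smooth V f -> smooth V g -> V (s, t) ->
  d_v (fun s t => P (f s t) (g s t)) s t =
    add4 (scal4 (pv f s t) (d_u P (f s t) (g s t))) (scal4 (pv g s t) (d_v P (f s t) (g s t))).
Proof.
  intros hU m [p1 [p2 [p3 p4]]] hf hg i; apply E4_ext.
  - apply (pv_comp U V _ f g s t hU m p1 hf hg i).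
  - apply (pv_comp U V _ f g s t hU m p2 hf hg i).
  - apply (pv_comp U V _ f g s t hU m p3 hf hg i).
  - apply (pv_comp U V _ f g s t hU m p4 hf hg i).
Qed.

(** * Second fundamental form, geometric frames and the Codazzi equation *)

Lemma nor_part_normal z u v w : detI z u v <> 0 ->
  is_normal_at z (nor_part z u v w) u v.
Proof.
  intros hd; unfold is_normal_at, nor_part, tan_part; dots.
  rewrite (dot_sym (d_v z u v) (d_u z u v)).
  fold (coefE z u v) (coefF z u v) (coefG z u v).
  unfold detI in *; split; field; auto.
Qed.

Lemma nor_part_dot z u v w n : is_normal_at z n u v -> dot (nor_part z u v w) n = dot w n.
Proof.
  intros [h1 h2]; unfold nor_part, tan_part; dots.
  rewrite (dot_sym (d_u z u v) n), (dot_sym (d_v z u v) n), h1, h2; ring.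
Qed.

Lemma push_normal z x u v n : is_normal_at z n u v -> dot n (push z x u v) = 0.
Proof. intros [h1 h2]; unfold push; dots; rewrite h1, h2; ring. Qed.

(** The coefficients of the second fundamental form of [z] in the direction of a
    normal field [l], in the classical notation L, M, N. *)
Definition sffL (z l : R -> R -> E4) u v := dot (d_u (d_u z) u v) (l u v).
Definition sffM (z l : R -> R -> E4) u v := dot (d_u (d_v z) u v) (l u v).
Definition sffN (z l : R -> R -> E4) u v := dot (d_v (d_v z) u v) (l u v).

(** Second derivatives of [z] alone survive: the derivatives of the components of
    [y] multiply tangent vectors.  The mixed coefficient is symmetric by the
    equality of mixed partial derivatives. *)
Lemma nabla'_push_dot U z x y l u v : open U -> smooth4 U z -> smoothT U y -> U (u, v) ->
  is_normal_at z (l u v) u v ->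
  dot (nabla' x (push z y) u v) (l u v) =
    fst (x u v) * fst (y u v) * sffL z l u v
    + (fst (x u v) * snd (y u v) + snd (x u v) * fst (y u v)) * sffM z l u v
    + snd (x u v) * snd (y u v) * sffN z l u v.
Proof.
  intros hU hz [y1 y2] h [n1 n2]; unfold nabla', push.
  assert (zu := smooth4_d_u U z hz); assert (zv := smooth4_d_v U z hz).
  assert (a1 := smooth4_scal U _ _ hU y1 zu); assert (a2 := smooth4_scal U _ _ hU y2 zv).
  rewrite (d_u_add U _ _ u v a1 a2 h), (d_v_add U _ _ u v a1 a2 h).
  rewrite (d_u_scal U _ _ u v y1 zu h), (d_u_scal U _ _ u v y2 zv h).
  rewrite (d_v_scal U _ _ u v y1 zu h), (d_v_scal U _ _ u v y2 zv h).
  rewrite <- (d_u_d_v U z u v hU hz h).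
  dots; rewrite (dot_sym (d_u z u v) (l u v)), (dot_sym (d_v z u v) (l u v)), n1, n2.
  unfold sffL, sffM, sffN; ring.
Qed.

Lemma smoothT_const U (a b : R) : smoothT U (fun _ _ => (a, b)).
Proof. split; apply smooth_const. Qed.

Lemma mean_curv_dot U z l u v : open U -> smooth4 U z -> U (u, v) ->
  is_normal_at z (l u v) u v ->
  dot (mean_curv z u v) (l u v) =
    1 / 2 * (/ detI z u v * (coefG z u v * sffL z l u v - 2 * coefF z u v * sffM z l u v
                             + coefE z u v * sffN z l u v)).
Proof.
  intros hU hz h n; unfold mean_curv, sigma; dots; rewrite !nor_part_dot by auto.
  rewrite !(nabla'_push_dot U) by (auto; apply smoothT_const); simpl; ring.
Qed.

Lemma mean_curv_normal z u v : detI z u v <> 0 -> is_normal_at z (mean_curv z u v) u v.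
Proof.
  intros hd; unfold mean_curv, sigma; split; dots;
  repeat match goal with |- context [dot (nor_part z u v ?w) (d_u z u v)] =>
    rewrite (proj1 (nor_part_normal z u v w hd)) end;
  repeat match goal with |- context [dot (nor_part z u v ?w) (d_v z u v)] =>
    rewrite (proj2 (nor_part_normal z u v w hd)) end; ring.
Qed.

Lemma normal_expand X Y b l w : orthonormal X Y b l ->
  dot w X = 0 -> dot w Y = 0 -> w = add4 (scal4 (dot w b) b) (scal4 (dot w l) l).
Proof.
  intros h hX hY; apply sub4_eq0, (orthonormal_complete X Y b l); auto;
  destruct h as [[xx [yy [bb ll]]] [[xy [xb xl]] [yb [yl bl]]]]; dots;
  rewrite ?(dot_sym b X), ?(dot_sym l X), ?(dot_sym b Y), ?(dot_sym l Y), ?(dot_sym l b);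
  rewrite ?bb, ?ll, ?xb, ?xl, ?yb, ?yl, ?bl, ?hX, ?hY; ring.
Qed.

Lemma normal_collinear X Y b l w : orthonormal X Y b l ->
  dot w X = 0 -> dot w Y = 0 -> dot w l = 0 -> w = scal4 (dot w b) b.
Proof.
  intros h hX hY hl; apply sub4_eq0, (orthonormal_complete X Y b l); auto;
  destruct h as [[xx [yy [bb ll]]] [[xy [xb xl]] [yb [yl bl]]]]; dots;
  rewrite ?(dot_sym b X), ?(dot_sym b Y);
  rewrite ?bb, ?xb, ?yb, ?bl, ?hX, ?hY, ?hl; ring.
Qed.

(** Everything that makes an orthonormal frame geometric concerns the component
    along [l]: the form with coefficients L, M, N must be trace-free (then [H] is a
    multiple of [b]) and [x], [y] must be isotropic for it. *)
Lemma geometric_frame_intro U z x y b l u v :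
  open U -> smooth4 U z -> smoothT U x -> smoothT U y -> U (u, v) ->
  detI z u v <> 0 ->
  orthonormal (push z x u v) (push z y u v) (b u v) (l u v) ->
  is_normal_at z (b u v) u v -> is_normal_at z (l u v) u v ->
  coefG z u v * sffL z l u v - 2 * coefF z u v * sffM z l u v + coefE z u v * sffN z l u v = 0 ->
  fst (x u v) * fst (x u v) * sffL z l u v
    + 2 * (fst (x u v) * snd (x u v)) * sffM z l u v + snd (x u v) * snd (x u v) * sffN z l u v = 0 ->
  fst (y u v) * fst (y u v) * sffL z l u v
    + 2 * (fst (y u v) * snd (y u v)) * sffM z l u v + snd (y u v) * snd (y u v) * sffN z l u v = 0 ->
  geometric_frame_at z x y b l u v.
Proof.
  intros hU hz hx hy h hd ho hb hl tr xx yy.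
  assert (no : forall w x, is_normal_at z w u v -> dot w (push z x u v) = 0).
  { intros; apply push_normal; auto. }
  assert (nn := fun w => nor_part_normal z u v w hd).
  destruct (ho) as [[eX [eY [eb el]]] [[eXY _] [_ [_ ebl]]]].
  split; [auto|split; [auto 10|split]].
  - exists (dot (mean_curv z u v) (b u v)).
    assert (nH := mean_curv_normal z u v hd).
    apply (normal_collinear _ _ _ _ _ ho); auto.
    rewrite (mean_curv_dot U), tr; auto; ring.
  - exists (dot (sigma z x x u v) (b u v)), (dot (sigma z y y u v) (b u v)), (dot (sigma z x y u v) (b u v)).
    unfold sigma; split; [|split].
    + apply (normal_collinear _ _ _ _ _ ho); auto.
      rewrite nor_part_dot, (nabla'_push_dot U) by auto; rewrite <- xx; ring.
    + unfold geom_mu; rewrite <- (nor_part_dot z u v _ (l u v)) by auto.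
      apply (normal_expand _ _ _ _ _ ho); auto.
    + apply (normal_collinear _ _ _ _ _ ho); auto.
      rewrite nor_part_dot, (nabla'_push_dot U) by auto; rewrite <- yy; ring.
Qed.

(** With [th1 = A du + B dv], [th2 = C du + D dv] and [om = <dX, Y>], the [X]-component
    of [d(dz) = 0] gives [dth1 = om ^ th2], and the [Y]-component of [d(dl) = 0] gives
    [dmu ^ th1 + mu dth1 + mu om ^ th2 = 0].  Substituting the first in the
    second gives [dmu ^ th1 + 2 mu dth1 = 0], which is the identity in coordinates.  The hypotheses are invariant
    under exchanging [X, A, B] with [Y, C, D], which yields the identity for [th2]. *)
Lemma codazzi_traceless U z l X Y A B C D mu u v : open U ->
  smooth4 U z -> smooth4 U l -> smooth4 U X -> smooth4 U Y -> 
  smooth U A -> smooth U B -> smooth U mu -> 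
  (forall u v, U (u, v) -> dot (X u v) (X u v) = 1 /\ dot (Y u v) (Y u v) = 1 /\ dot (X u v) (Y u v) = 0) ->
  (forall u v, U (u, v) -> d_u z u v = add4 (scal4 (A u v) (X u v)) (scal4 (C u v) (Y u v))) ->
  (forall u v, U (u, v) -> d_v z u v = add4 (scal4 (B u v) (X u v)) (scal4 (D u v) (Y u v))) ->
  (forall u v, U (u, v) -> d_u l u v =
     scal4 (- mu u v) (add4 (scal4 (A u v) (Y u v)) (scal4 (C u v) (X u v)))) ->
  (forall u v, U (u, v) -> d_v l u v =
     scal4 (- mu u v) (add4 (scal4 (B u v) (Y u v)) (scal4 (D u v) (X u v)))) ->
  U (u, v) ->
  pv mu u v * A u v + 2 * mu u v * pv A u v = pu mu u v * B u v + 2 * mu u v * pu B u v.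
Proof.
  intros hU hz hl hX hY sA sB smu ho zu zv lu lv h.
  assert (eA : pv A u v = dot (d_v X u v) (d_u z u v) + dot (X u v) (d_v (d_u z) u v)).
  { rewrite <- (pv_dot U) by auto using smooth4_d_u.
    apply (pv_ext U); auto; intros s t i; rewrite zu by auto; destruct (ho s t i) as [e1 [e2 e3]].
    dots; rewrite e1, e3; ring. }
  assert (eB : pu B u v = dot (d_u X u v) (d_v z u v) + dot (X u v) (d_u (d_v z) u v)).
  { rewrite <- (pu_dot U) by auto using smooth4_d_v.
    apply (pu_ext U); auto; intros s t i; rewrite zv by auto; destruct (ho s t i) as [e1 [e2 e3]].
    dots; rewrite e1, e3; ring. }
  assert (eMA : pv mu u v * A u v + mu u v * pv A u v =
    - (dot (d_v Y u v) (d_u l u v) + dot (Y u v) (d_v (d_u l) u v))).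
  { rewrite <- (pv_dot U), <- (pv_mult U) by auto using smooth4_d_u.
    replace (- pv (fun s t => dot (Y s t) (d_u l s t)) u v)
      with (pv (fun s t => - dot (Y s t) (d_u l s t)) u v) by apply Derive_opp.
    apply (pv_ext U); auto; intros s t i; rewrite lu by auto; destruct (ho s t i) as [e1 [e2 e3]].
    dots; rewrite e2, (dot_sym (Y s t)), e3; ring. }
  assert (eMB : pu mu u v * B u v + mu u v * pu B u v =
    - (dot (d_u Y u v) (d_v l u v) + dot (Y u v) (d_u (d_v l) u v))).
  { rewrite <- (pu_dot U), <- (pu_mult U) by auto using smooth4_d_v.
    replace (- pu (fun s t => dot (Y s t) (d_v l s t)) u v)
      with (pu (fun s t => - dot (Y s t) (d_v l s t)) u v) by apply Derive_opp.
    apply (pu_ext U); auto; intros s t i; rewrite lv by auto; destruct (ho s t i) as [e1 [e2 e3]].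
    dots; rewrite e2, (dot_sym (Y s t)), e3; ring. }
  assert (dv : forall P Q c, smooth4 U P -> smooth4 U Q ->
    (forall u v, U (u, v) -> dot (P u v) (Q u v) = c) ->
    dot (d_v P u v) (Q u v) + dot (P u v) (d_v Q u v) = 0 /\
    dot (d_u P u v) (Q u v) + dot (P u v) (d_u Q u v) = 0).
  { intros P Q c hP hQ e; rewrite <- (pv_dot U), <- (pu_dot U) by auto; split.
    - etransitivity; [apply (pv_ext U _ (fun _ _ => c) u v hU e h)|apply (Derive_const c)].
    - etransitivity; [apply (pu_ext U _ (fun _ _ => c) u v hU e h)|apply (Derive_const c)]. }
  destruct (dv X X 1) as [xv xu]; [auto|auto|apply ho|].
  destruct (dv Y Y 1) as [yv yu]; [auto|auto|apply ho|].
  destruct (dv X Y 0) as [wv wu]; [auto|auto|apply ho|].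
  rewrite (d_u_d_v U) in eB, eMB by auto.
  rewrite zu in eA by auto; rewrite zv in eB by auto; rewrite lu in eMA by auto; rewrite lv in eMB by auto.
  revert eA eB eMA eMB; dots.
  rewrite (dot_sym (X u v) (d_v X u v)) in xv; rewrite (dot_sym (X u v) (d_u X u v)) in xu.
  rewrite (dot_sym (Y u v) (d_v Y u v)) in yv; rewrite (dot_sym (Y u v) (d_u Y u v)) in yu.
  rewrite (dot_sym (X u v)) in wv, wu.
  replace (dot (d_v X u v) (X u v)) with 0 by lra.
  replace (dot (d_u X u v) (X u v)) with 0 by lra.
  replace (dot (d_v Y u v) (Y u v)) with 0 by lra.
  replace (dot (d_u Y u v) (Y u v)) with 0 by lra.
  replace (dot (d_v Y u v) (X u v)) with (- dot (d_v X u v) (Y u v)) by lra.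
  replace (dot (d_u Y u v) (X u v)) with (- dot (d_u X u v) (Y u v)) by lra.
  intros eA eB; rewrite eA, eB; intros eMA eMB; lra.
Qed.

(** * From a frame of asymptotic directions to canonical parameters *)

Lemma c1_add p q : c1 (add4 p q) = c1 p + c1 q.
Proof. reflexivity. Qed.

Lemma c1_scal a p : c1 (scal4 a p) = a * c1 p.
Proof. reflexivity. Qed.

Lemma c2_add p q : c2 (add4 p q) = c2 p + c2 q.
Proof. reflexivity. Qed.

Lemma c2_scal a p : c2 (scal4 a p) = a * c2 p.
Proof. reflexivity. Qed.

Lemma c3_add p q : c3 (add4 p q) = c3 p + c3 q.
Proof. reflexivity. Qed.

Lemma c3_scal a p : c3 (scal4 a p) = a * c3 p.
Proof. reflexivity. Qed.

Lemma c4_add p q : c4 (add4 p q) = c4 p + c4 q.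
Proof. reflexivity. Qed.

Lemma c4_scal a p : c4 (scal4 a p) = a * c4 p.
Proof. reflexivity. Qed.

Ltac comps := apply E4_ext;
  repeat rewrite ?c1_add, ?c2_add, ?c3_add, ?c4_add, ?c1_scal, ?c2_scal, ?c3_scal, ?c4_scal.

(** Differentiation of [<z_u, l> = <z_v, l> = 0]. *)
Lemma sff_as_derivative_of_normal U z l u v : open U -> smooth4 U z -> smooth4 U l ->
  (forall u v, U (u, v) -> is_normal_at z (l u v) u v) -> U (u, v) ->
  sffL z l u v = - dot (d_u z u v) (d_u l u v) /\
  sffM z l u v = - dot (d_v z u v) (d_u l u v) /\
  sffM z l u v = - dot (d_u z u v) (d_v l u v) /\
  sffN z l u v = - dot (d_v z u v) (d_v l u v).
Proof.
  intros hU hz hl hn h.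
  assert (zu := smooth4_d_u U z hz); assert (zv := smooth4_d_v U z hz).
  assert (n1 : forall s t, U (s, t) -> dot (d_u z s t) (l s t) = 0).
  { intros s t i; rewrite dot_sym; apply hn, i. }
  assert (n2 : forall s t, U (s, t) -> dot (d_v z s t) (l s t) = 0).
  { intros s t i; rewrite dot_sym; apply hn, i. }
  assert (zero_u : forall f, (forall s t, U (s, t) -> f s t = 0) -> pu f u v = 0).
  { intros f e; etransitivity; [apply (pu_ext U f (fun _ _ => 0) u v hU e h)|apply (Derive_const 0)]. }
  assert (zero_v : forall f, (forall s t, U (s, t) -> f s t = 0) -> pv f u v = 0).
  { intros f e; etransitivity; [apply (pv_ext U f (fun _ _ => 0) u v hU e h)|apply (Derive_const 0)]. }
  assert (e1 := zero_u _ n1); assert (e2 := zero_u _ n2).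
  assert (e3 := zero_v _ n1); assert (e4 := zero_v _ n2).
  rewrite (pu_dot U) in e1, e2 by auto; rewrite (pv_dot U) in e3, e4 by auto.
  rewrite <- (d_u_d_v U) in e3 by auto.
  unfold sffL, sffM, sffN; repeat split; lra.
Qed.

(** A unit frame [X, Y] isotropic for the second fundamental form in the direction
    [l], with dual coframe [A du + B dv], [C du + D dv]; the last two equations are the
    Weingarten equations of a parallel [l] in this frame. *)
Definition asymptotic_frame (S : R * R -> Prop) (z X Y b l : R -> R -> E4)
    (A B C D mu : R -> R -> R) : Prop :=
  (smooth4 S X /\ smooth4 S Y /\ smooth4 S b /\ smooth4 S l) /\
  (smooth S A /\ smooth S B /\ smooth S C /\ smooth S D /\ smooth S mu) /\
  forall u v, S (u, v) ->
    0 < mu u v /\ A u v * D u v - B u v * C u v <> 0 /\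
    orthonormal (X u v) (Y u v) (b u v) (l u v) /\
    d_u z u v = add4 (scal4 (A u v) (X u v)) (scal4 (C u v) (Y u v)) /\
    d_v z u v = add4 (scal4 (B u v) (X u v)) (scal4 (D u v) (Y u v)) /\
    d_u l u v = scal4 (- mu u v) (add4 (scal4 (A u v) (Y u v)) (scal4 (C u v) (X u v))) /\
    d_v l u v = scal4 (- mu u v) (add4 (scal4 (B u v) (Y u v)) (scal4 (D u v) (X u v))).

Lemma pu_sqrt U f u v : smooth U f -> U (u, v) -> 0 < f u v ->
  pu (fun u v => sqrt (f u v)) u v = pu f u v / (2 * sqrt (f u v)).
Proof.
  intros hf h h0; apply is_derive_unique, (is_derive_sqrt (fun s => f s v)); auto.
  eapply smooth_is_u; eauto.
Qed.

Lemma pv_sqrt U f u v : smooth U f -> U (u, v) -> 0 < f u v ->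
  pv (fun u v => sqrt (f u v)) u v = pv f u v / (2 * sqrt (f u v)).
Proof.
  intros hf h h0; apply is_derive_unique, (is_derive_sqrt (fun t => f u t)); auto.
  eapply smooth_is_v; eauto.
Qed.

(** The hypothesis is [dmu ^ th + 2 mu dth = 0] for [th = A du + B dv], which is
    [2 sqrt mu d(sqrt mu th) = 0]. *)
Lemma sqrt_weight_closed U A B mu u v : open U -> smooth U A -> smooth U B -> smooth U mu ->
  (forall u v, U (u, v) -> 0 < mu u v) -> U (u, v) ->
  pv mu u v * A u v + 2 * mu u v * pv A u v = pu mu u v * B u v + 2 * mu u v * pu B u v ->
  pv (fun u v => sqrt (mu u v) * A u v) u v = pu (fun u v => sqrt (mu u v) * B u v) u v.
Proof.
  intros hU hA hB hm m0 h e.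
  assert (hr := smooth_sqrt U mu hU hm m0).
  rewrite (pv_mult U _ A u v hr hA h), (pu_mult U _ B u v hr hB h).
  rewrite (pv_sqrt U), (pu_sqrt U) by auto.
  assert (r0 := sqrt_lt_R0 _ (m0 u v h)); assert (rr := sqrt_sqrt _ (Rlt_le _ _ (m0 u v h))).
  apply (Rmult_eq_reg_l (2 * sqrt (mu u v))); [|lra].
  set (r := sqrt (mu u v)) in *; rewrite <- rr in e; field_simplify; [|lra|lra]; lra.
Qed.

(** In the parameters with [dp = sqrt mu th1], [dq = sqrt mu th2] the coordinate fields
    are [X / sqrt mu] and [Y / sqrt mu], so that the coefficients of the metric are as
    claimed and, by the Weingarten equations, L = N = 0 and M = 1. *)
Lemma canonical_of_asymptotic_frame u0 v0 d z X Y b l A B C D mu : 0 < d ->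
  smooth4 (square u0 v0 d) z ->
  asymptotic_frame (square u0 v0 d) z X Y b l A B C D mu ->
  exists (V W : R * R -> Prop) (f g p q : R -> R -> R),
    W (u0, v0) /\ (forall u v, W (u, v) -> square u0 v0 d (u, v)) /\
    diffeo V W f g p q /\ canonical_parameters V (reparam z f g).
Proof.
  intros d0; set (S := square u0 v0 d); intros hz [[sX [sY [sb sl]]] [[sA [sB [sC [sD smu]]]] H]].
  assert (hS : open S) by apply square_open.
  assert (m0 : forall u v, S (u, v) -> 0 < mu u v) by (intros; apply H; auto).
  set (r := fun u v => sqrt (mu u v)).
  assert (sr : smooth S r) by (apply smooth_sqrt; auto).
  destruct (poincare_lemma u0 v0 d (fun u v => r u v * A u v) (fun u v => r u v * B u v)) as [p [sp [pU pV]]];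
    auto using smooth_mult.
  { intros u v h; apply (sqrt_weight_closed S); auto.
    apply (codazzi_traceless S z l X Y A B C D mu); auto; try (intros s t i; apply H; auto).
    intros s t i; destruct (H s t i) as [_ [_ [[[? [? _]] [[? _] _]] _]]]; auto. }
  destruct (poincare_lemma u0 v0 d (fun u v => r u v * C u v) (fun u v => r u v * D u v)) as [q [sq [qU qV]]];
    auto using smooth_mult.
  { intros u v h; apply (sqrt_weight_closed S); auto.
    apply (codazzi_traceless S z l Y X C D A B mu); auto; intros s t i;
      destruct (H s t i) as [_ [_ [[[? [? _]] [[? _] _]] [e1 [e2 [e3 e4]]]]]].
    - rewrite (dot_sym (Y s t) (X s t)); auto.
    - rewrite e1; comps; ring.
    - rewrite e2; comps; ring.
    - rewrite e3; comps; ring.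
    - rewrite e4; comps; ring. }
  fold S in sp, sq, pU, pV, qU, qV.
  assert (ej : forall u v, S (u, v) -> jac p q u v = mu u v * (A u v * D u v - B u v * C u v)).
  { intros u v h; unfold jac.
    rewrite (is_derive_unique _ _ _ (pU u v h) : pu p u v = _), (is_derive_unique _ _ _ (pV u v h) : pv p u v = _),
      (is_derive_unique _ _ _ (qU u v h) : pu q u v = _), (is_derive_unique _ _ _ (qV u v h) : pv q u v = _).
    rewrite <- (sqrt_sqrt (mu u v)) by (apply Rlt_le; auto); unfold r; ring. }
  destruct (inverse_function S p q u0 v0 hS sp sq) as [V [W [f [g [W0 [WS [dif der]]]]]]].
  { split; simpl; rewrite Rminus_eq_0, Rabs_R0; exact d0. }
  { intros u v h; rewrite (ej u v h); destruct (H u v h) as [h1 [h2 _]].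
    apply Rmult_integral_contrapositive_currified; auto; lra. }
  exists V, W, f, g, p, q; split; [auto|split; [auto|split; [auto|]]].
  assert (hV : open V) by apply dif.
  destruct (dif) as [_ [_ [sf [sg [_ [_ [VW _]]]]]]].
  assert (VS : forall s t, V (s, t) -> S (f s t, g s t)) by auto.
  assert (wz : smooth4 V (reparam z f g)) by (apply (smooth4_comp S V z f g); auto).
  assert (r0 : forall u v, S (u, v) -> 0 < r u v /\ r u v * r u v = mu u v).
  { intros u v h; split; [apply sqrt_lt_R0; auto|apply sqrt_sqrt, Rlt_le; auto]. }
  (* The new coordinate fields are the fields dual to [dp, dq].  Applied to [z]
     this rule gives [X / r] and [Y / r], applied to [l] it gives [- r Y] and
     [- r X]. *)
  assert (ds : forall P a1 a2 a3 s t, smooth4 S P -> V (s, t) ->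
    d_u P (f s t) (g s t) = scal4 a1 (add4 (scal4 (A (f s t) (g s t)) a2) (scal4 (C (f s t) (g s t)) a3)) ->
    d_v P (f s t) (g s t) = scal4 a1 (add4 (scal4 (B (f s t) (g s t)) a2) (scal4 (D (f s t) (g s t)) a3)) ->
    d_u (fun s t => P (f s t) (g s t)) s t = scal4 (a1 / r (f s t) (g s t)) a2 /\
    d_v (fun s t => P (f s t) (g s t)) s t = scal4 (a1 / r (f s t) (g s t)) a3).
  { intros P a1 a2 a3 s t hP h e1 e2.
    rewrite (d_u_comp S V P f g s t hS VS hP sf sg h), (d_v_comp S V P f g s t hS VS hP sf sg h), e1, e2.
    destruct (der s t h) as [-> [-> [-> ->]]]; assert (i := VS s t h).
    rewrite (ej _ _ i).
    rewrite (is_derive_unique _ _ _ (pU _ _ i) : pu p _ _ = _), (is_derive_unique _ _ _ (pV _ _ i) : pv p _ _ = _),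
      (is_derive_unique _ _ _ (qU _ _ i) : pu q _ _ = _), (is_derive_unique _ _ _ (qV _ _ i) : pv q _ _ = _).
    destruct (H _ _ i) as [_ [nz _]]; destruct (r0 _ _ i) as [r1 r2]; rewrite <- r2.
    split; comps; field; split; auto; lra. }
  assert (dw : forall s t, V (s, t) ->
    d_u (reparam z f g) s t = scal4 (1 / r (f s t) (g s t)) (X (f s t) (g s t)) /\
    d_v (reparam z f g) s t = scal4 (1 / r (f s t) (g s t)) (Y (f s t) (g s t))).
  { intros s t h; destruct (H _ _ (VS s t h)) as [_ [_ [_ [e1 [e2 _]]]]].
    apply ds; auto; [rewrite e1|rewrite e2]; comps; ring. }
  assert (dl : forall s t, V (s, t) ->
    d_u (fun s t => l (f s t) (g s t)) s t = scal4 (- r (f s t) (g s t)) (Y (f s t) (g s t)) /\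
    d_v (fun s t => l (f s t) (g s t)) s t = scal4 (- r (f s t) (g s t)) (X (f s t) (g s t))).
  { intros s t h; destruct (H _ _ (VS s t h)) as [_ [_ [_ [_ [_ [e1 e2]]]]]].
    destruct (r0 _ _ (VS s t h)) as [r1 r2].
    replace (- r (f s t) (g s t)) with (- mu (f s t) (g s t) / r (f s t) (g s t)) by (rewrite <- r2; field; lra).
    apply ds; auto. }
  set (w := reparam z f g) in *.
  set (b' := fun s t => b (f s t) (g s t)); set (l' := fun s t => l (f s t) (g s t)) in *.
  set (r' := fun s t => r (f s t) (g s t)).
  assert (sl' : smooth4 V l') by (apply (smooth4_comp S V l f g); auto).
  assert (sb' : smooth4 V b') by (apply (smooth4_comp S V b f g); auto).
  assert (sr' : smooth V r') by (apply (smooth_comp S V r f g); auto).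
  assert (nl : forall s t, V (s, t) -> is_normal_at w (l' s t) s t).
  { intros s t h; unfold is_normal_at; destruct (dw s t h) as [-> ->]; dots; unfold l'.
    destruct (H _ _ (VS s t h)) as [_ [_ [[_ [[_ [_ xl]] [_ [yl _]]]] _]]].
    rewrite (dot_sym (l _ _)), xl, (dot_sym (l _ _)), yl; split; ring. }
  assert (nb : forall s t, V (s, t) -> is_normal_at w (b' s t) s t).
  { intros s t h; unfold is_normal_at; destruct (dw s t h) as [-> ->]; dots; unfold b'.
    destruct (H _ _ (VS s t h)) as [_ [_ [[_ [[_ [xb _]] [yb _]]] _]]].
    rewrite (dot_sym (b _ _)), xb, (dot_sym (b _ _)), yb; split; ring. }
  assert (I : forall s t, V (s, t) ->
    coefE w s t = / mu (f s t) (g s t) /\ coefF w s t = 0 /\ coefG w s t = / mu (f s t) (g s t)).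
  { intros s t h; unfold coefE, coefF, coefG; destruct (dw s t h) as [-> ->]; dots.
    destruct (H _ _ (VS s t h)) as [_ [_ [[[xx [yy _]] [[xy _] _]] _]]].
    rewrite xx, yy, xy; destruct (r0 _ _ (VS s t h)) as [r1 <-].
    repeat split; field; lra. }
  assert (II : forall s t, V (s, t) -> sffL w l' s t = 0 /\ sffM w l' s t = 1 /\ sffN w l' s t = 0).
  { intros s t h; destruct (sff_as_derivative_of_normal V w l' s t hV wz sl' nl h) as [-> [-> [_ ->]]].
    destruct (dw s t h) as [-> ->], (dl s t h) as [-> ->]; dots.
    destruct (H _ _ (VS s t h)) as [_ [_ [[[xx [yy _]] [[xy _] _]] _]]].
    rewrite (dot_sym (Y _ _) (X _ _)), xy, yy; destruct (r0 _ _ (VS s t h)) as [r1 _].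
    repeat split; field; lra. }
  exists (fun s t => (r' s t, 0)), (fun s t => (0, r' s t)), b', l'; split.
  - split.
    + exact (conj (conj sr' (smooth_const V 0)) (conj (conj (smooth_const V 0) sr') (conj sb' sl'))).
    + intros s t h; destruct (I s t h) as [iE [iF iG]], (II s t h) as [iL [iM iN]].
      assert (mp := m0 _ _ (VS s t h)).
      apply (geometric_frame_intro V); auto.
      * split; simpl; [first [exact sr' | apply smooth_const]|first [exact sr' | apply smooth_const]].
      * split; simpl; [first [exact sr' | apply smooth_const]|first [exact sr' | apply smooth_const]].
      * unfold detI; rewrite iE, iF, iG; apply Rgt_not_eq.
        rewrite Rmult_0_l, Rminus_0_r; apply Rmult_lt_0_compat; apply Rinv_0_lt_compat; auto.
      * unfold push; simpl; destruct (dw s t h) as [-> ->]; unfold r', b', l'.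
        destruct (r0 _ _ (VS s t h)) as [r1 _].
        replace (add4 _ _) with (X (f s t) (g s t)) by (comps; field; lra).
        replace (add4 _ _) with (Y (f s t) (g s t)) by (comps; field; lra).
        apply H; auto.
      * rewrite iF, iL, iN; ring.
      * rewrite iL, iN; simpl; ring.
      * rewrite iL, iN; simpl; ring.
  - intros s t h; destruct (I s t h) as [iE [iF iG]], (II s t h) as [iL [iM iN]].
    assert (mp := m0 _ _ (VS s t h)).
    unfold geom_mu; rewrite (nabla'_push_dot V); auto.
    2: { split; simpl; [apply smooth_const|exact sr']. }
    rewrite iL, iM, iN, iE, iF, iG; simpl.
    replace (_ + _) with (mu (f s t) (g s t)).
    2: { destruct (r0 _ _ (VS s t h)) as [_ <-]; unfold r'; ring. }
    rewrite Rabs_pos_eq by lra; unfold Rdiv; rewrite Rmult_1_l; auto.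
Qed.

(** * Existence of a frame of asymptotic directions *)

(** The vector [E z_v - F z_u] has square norm [E (E G - F^2)] and is nonzero by
    independence of [z_u] and [z_v]. *)
Lemma immersion_det_pos U z u v : surface U z -> U (u, v) ->
  0 < coefE z u v /\ 0 < detI z u v.
Proof.
  intros [_ [_ imm]] h; specialize (imm u v h).
  assert (E0 : 0 < coefE z u v).
  { destruct (Rle_lt_or_eq_dec _ _ (dot_self_ge0 (d_u z u v))) as [p|e]; auto.
    assert (e' := dot_self_eq0 _ (eq_sym e)).
    destruct (imm 1 0) as [c _]; [|lra].
    rewrite e'; comps; unfold zero4; unfold c1, c2, c3, c4; simpl; ring. }
  split; auto.
  set (n := add4 (scal4 (- coefF z u v) (d_u z u v)) (scal4 (coefE z u v) (d_v z u v))).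
  assert (nn : dot n n = coefE z u v * detI z u v).
  { unfold n, detI; dots; rewrite (dot_sym (d_v z u v) (d_u z u v)).
    fold (coefE z u v) (coefF z u v) (coefG z u v); ring. }
  assert (n0 := dot_self_ge0 n).
  destruct (Rle_lt_or_eq_dec _ _ n0) as [p|e].
  - rewrite nn in p; apply (Rmult_lt_reg_l (coefE z u v)); auto; lra.
  - destruct (imm _ _ (dot_self_eq0 _ (eq_sym e))) as [_ c]; lra.
Qed.

Lemma gram_schmidt (P Q b l : E4) (E F G s t : R) :
  E = dot P P -> F = dot P Q -> G = dot Q Q -> 0 < s -> 0 < t ->
  s * s = E -> t * t = E * G - F * F ->
  dot b P = 0 -> dot b Q = 0 -> dot l P = 0 -> dot l Q = 0 ->
  dot b b = 1 -> dot l l = 1 -> dot b l = 0 ->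
  orthonormal (scal4 (/ s) P) (add4 (scal4 (- F / (s * t)) P) (scal4 (E / (s * t)) Q)) b l.
Proof.
  intros eE eF eG s0 t0 ss tt bP bQ lP lQ bb ll bl.
  unfold orthonormal; dots.
  rewrite (dot_sym Q P), (dot_sym P b), (dot_sym Q b), (dot_sym P l), (dot_sym Q l).
  rewrite <- eE, <- eF, <- eG, bP, bQ, lP, lQ, bb, ll, bl.
  repeat split; try (rewrite <- ss; field; lra); try ring.
  transitivity (E * (E * G - F * F) / (s * s * (t * t))); [field; lra|].
  rewrite tt, ss; field; split; rewrite <- ?tt, <- ?ss; nra.
Qed.

(** Here [a = h(e1, e1) = - h(e2, e2)] and [c = h(e1, e2)] are the two coefficients of
    the trace-free form in an orthonormal tangent frame, in which
    [z_u = s e1] and [z_v = k e1 + h e2]. *)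
Lemma weingarten_in_frame (e1 e2 b l P Q lu lv : E4) (s k h L M N a c : R) :
  orthonormal e1 e2 b l -> s <> 0 -> h <> 0 ->
  P = scal4 s e1 -> Q = add4 (scal4 k e1) (scal4 h e2) ->
  dot P lu = - L -> dot Q lu = - M -> dot P lv = - M -> dot Q lv = - N ->
  dot lu b = 0 -> dot lv b = 0 -> dot lu l = 0 -> dot lv l = 0 ->
  L = s * s * a -> M = s * (k * a + h * c) -> N = k * (k * a + h * c) + h * (k * c - h * a) ->
  lu = scal4 (- s) (add4 (scal4 a e1) (scal4 c e2)) /\
  lv = add4 (scal4 (- k) (add4 (scal4 a e1) (scal4 c e2)))
            (scal4 (- h) (add4 (scal4 c e1) (scal4 (- a) e2))).
Proof.
  intros ho s0 h0 eP eQ Lu Mu Mv Nv ub vb ul vl eL eM eN.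
  rewrite eP in Lu, Mv; rewrite eQ in Mu, Nv; revert Lu Mu Mv Nv; dots; intros Lu Mu Mv Nv.
  assert (u1 : dot e1 lu = - s * a).
  { apply (Rmult_eq_reg_l s); auto; rewrite Lu, eL; ring. }
  assert (u2 : dot e2 lu = - s * c).
  { apply (Rmult_eq_reg_l h); auto; rewrite u1 in Mu; lra. }
  assert (v1 : dot e1 lv = - (k * a + h * c)).
  { apply (Rmult_eq_reg_l s); auto; rewrite Mv, eM; ring. }
  assert (v2 : dot e2 lv = - (k * c - h * a)).
  { apply (Rmult_eq_reg_l h); auto; rewrite v1 in Nv; lra. }
  split; [rewrite (orthonormal_expand e1 e2 b l lu ho) at 1|rewrite (orthonormal_expand e1 e2 b l lv ho) at 1];
    rewrite (dot_sym _ e1), (dot_sym _ e2), ?u1, ?u2, ?v1, ?v2, ?ub, ?vb, ?ul, ?vl; comps; ring.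
Qed.

Lemma rotated_frame (e1 e2 b l : E4) (k1 k2 : R) : k1 * k1 + k2 * k2 = 1 ->
  orthonormal e1 e2 b l ->
  orthonormal (add4 (scal4 k1 e1) (scal4 k2 e2)) (add4 (scal4 (- k2) e1) (scal4 k1 e2)) b l.
Proof.
  intros hk [[xx [yy [bb ll]]] [[xy [xb xl]] [yb [yl bl]]]].
  unfold orthonormal; dots; rewrite (dot_sym e2 e1), xx, yy, bb, ll, xy, xb, xl, yb, yl, bl.
  repeat split; lra.
Qed.

(** If the frame [e1, e2] is rotated by [phi], the form with coefficients [a, c] takes
    on its first vector the value [a cos(2 phi) + c sin(2 phi)].  It vanishes for
    [cos(2 phi) = c / rho], [sin(2 phi) = - a / rho], and [k1, k2] are the cosine and
    sine of half that angle.  The formula is smooth where [cos(2 phi) > -1], that is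
    [c + rho > 0]. *)
Lemma half_angle (a c rho : R) : 0 < rho -> rho * rho = a * a + c * c -> 0 < c + rho ->
  let k1 := sqrt ((1 + c / rho) / 2) in
  let k2 := - a / rho / (2 * k1) in
  0 < (1 + c / rho) / 2 /\ 0 < k1 /\ k1 * k1 + k2 * k2 = 1 /\
  - 2 * (k1 * k2) * rho = a /\ rho * (k1 * k1 - k2 * k2) = c.
Proof.
  intros r0 rr h k1 k2.
  assert (p : 0 < (1 + c / rho) / 2).
  { replace ((1 + c / rho) / 2) with ((c + rho) / (2 * rho)) by (field; lra).
    apply Rdiv_lt_0_compat; lra. }
  assert (k0 : 0 < k1) by (apply sqrt_lt_R0; auto).
  assert (kk : k1 * k1 = (1 + c / rho) / 2) by (apply sqrt_sqrt; lra).
  assert (kk2 : k2 * k2 = (1 - c / rho) / 2).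
  { replace (k2 * k2) with ((a * a) / (rho * rho) / (4 * (k1 * k1))) by (unfold k2; field; lra).
    rewrite kk; replace (a * a) with (rho * rho - c * c) by lra; field; lra. }
  repeat split; auto.
  - rewrite kk, kk2; field; lra.
  - unfold k2; field; lra.
  - rewrite kk, kk2; field; lra.
Qed.

Lemma locally_2d_pos f u v : continuity_2d_pt f u v -> 0 < f u v ->
  locally_2d (fun s t => 0 < f s t) u v.
Proof.
  intros hc h; generalize (hc (mkposreal _ h)); apply locally_2d_mono; simpl.
  intros s t i; apply Rabs_def2 in i; lra.
Qed.

(** Since the normal plane has dimension two, a unit normal field orthogonal to a
    parallel one is parallel: [<dl, b> = - <l, db> = 0]. *)
Lemma parallel_binormal U z b l u v : open U -> smooth4 U z -> smooth4 U b -> smooth4 U l ->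
  (forall u v, U (u, v) -> detI z u v <> 0) ->
  (forall (X : tfield) u v, U (u, v) -> normal_D z X b u v = zero4) ->
  (forall u v, U (u, v) -> is_normal_at z (l u v) u v /\ dot (l u v) (l u v) = 1 /\ dot (l u v) (b u v) = 0) ->
  U (u, v) ->
  dot (d_u l u v) (b u v) = 0 /\ dot (d_v l u v) (b u v) = 0 /\
  dot (d_u l u v) (l u v) = 0 /\ dot (d_v l u v) (l u v) = 0.
Proof.
  intros hU hz hb hl hd hD hn h; destruct (hn u v h) as [n _].
  assert (bu : dot (d_u b u v) (l u v) = 0).
  { rewrite <- (dot_zero (l u v)), <- (hD coord_u u v h); unfold normal_D.
    rewrite nor_part_dot by auto; unfold nabla'; simpl; dots; ring. }
  assert (bv : dot (d_v b u v) (l u v) = 0).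
  { rewrite <- (dot_zero (l u v)), <- (hD coord_v u v h); unfold normal_D.
    rewrite nor_part_dot by auto; unfold nabla'; simpl; dots; ring. }
  assert (const_u : forall f c, (forall s t, U (s, t) -> f s t = c) -> pu f u v = 0).
  { intros f c e; etransitivity; [apply (pu_ext U f (fun _ _ => c) u v hU e h)|apply (Derive_const c)]. }
  assert (const_v : forall f c, (forall s t, U (s, t) -> f s t = c) -> pv f u v = 0).
  { intros f c e; etransitivity; [apply (pv_ext U f (fun _ _ => c) u v hU e h)|apply (Derive_const c)]. }
  assert (e1 := const_u _ _ (fun s t i => proj2 (proj2 (hn s t i)))).
  assert (e2 := const_v _ _ (fun s t i => proj2 (proj2 (hn s t i)))).
  assert (e3 := const_u _ _ (fun s t i => proj1 (proj2 (hn s t i)))).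
  assert (e4 := const_v _ _ (fun s t i => proj1 (proj2 (hn s t i)))).
  rewrite (pu_dot U) in e1, e3 by auto; rewrite (pv_dot U) in e2, e4 by auto.
  rewrite (dot_sym (l u v)) in e1, e2.
  rewrite (dot_sym (l u v) (d_u l u v)) in e3; rewrite (dot_sym (l u v) (d_v l u v)) in e4.
  repeat split; lra.
Qed.

(** The triple vector product of [z_u, z_v, b] has norm [sqrt (E G - F^2)]. *)
Lemma unit_binormal U z b : open U -> smooth4 U z -> smooth4 U b ->
  (forall u v, U (u, v) -> 0 < detI z u v) ->
  (forall u v, U (u, v) -> is_normal_at z (b u v) u v /\ dot (b u v) (b u v) = 1) ->
  exists l, smooth4 U l /\ forall u v, U (u, v) ->
    is_normal_at z (l u v) u v /\ dot (l u v) (l u v) = 1 /\ dot (l u v) (b u v) = 0.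
Proof.
  intros hU hz hb hd hn.
  assert (sE : smooth U (detI z)).
  { unfold detI; apply smooth_minus; auto; apply smooth_mult; auto; apply smooth_dot;
      auto using smooth4_d_u, smooth4_d_v. }
  exists (fun u v => scal4 (/ sqrt (detI z u v)) (cross (d_u z u v) (d_v z u v) (b u v))); split.
  - apply smooth4_scal; auto.
    + apply smooth_inv; auto; [apply smooth_sqrt; auto|].
      intros u v h; apply Rgt_not_eq, sqrt_lt_R0; auto.
    + apply smooth4_cross; auto using smooth4_d_u, smooth4_d_v.
  - intros u v h; destruct (hn u v h) as [[n1 n2] bb].
    destruct (cross_orth (d_u z u v) (d_v z u v) (b u v)) as [o1 [o2 o3]].
    unfold is_normal_at; dots; rewrite o1, o2, o3, cross_norm.
    rewrite (dot_sym (d_u z u v) (b u v)), (dot_sym (d_v z u v) (b u v)), n1, n2, bb, (dot_sym (d_v z u v) (d_u z u v)).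
    fold (coefE z u v) (coefF z u v) (coefG z u v).
    assert (p := sqrt_lt_R0 _ (hd u v h)); assert (ss := sqrt_sqrt _ (Rlt_le _ _ (hd u v h))).
    set (s := sqrt _) in *; repeat split; try ring.
    transitivity (detI z u v / (s * s)); [unfold det3, detI; field; lra|].
    rewrite ss; field; specialize (hd u v h); lra.
Qed.

(** The square is chosen so that [rho] and [c + rho] stay positive on it, where the
    half-angle formulas apply to the Gram-Schmidt frame of [z_u, z_v].  The sign
    condition at the base point gives [c + rho > 0] there; it costs nothing, as it
    can be met by replacing [l] with its opposite. *)
Lemma exists_asymptotic_frame U z b l u0 v0 : open U -> smooth4 U z -> smooth4 U b -> smooth4 U l ->
  (forall u v, U (u, v) -> 0 < coefE z u v /\ 0 < detI z u v) ->
  (forall u v, U (u, v) -> is_normal_at z (b u v) u v /\ dot (b u v) (b u v) = 1) ->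
  (forall u v, U (u, v) ->
    is_normal_at z (l u v) u v /\ dot (l u v) (l u v) = 1 /\ dot (l u v) (b u v) = 0) ->
  (forall u v, U (u, v) ->
    coefG z u v * sffL z l u v - 2 * coefF z u v * sffM z l u v + coefE z u v * sffN z l u v = 0) ->
  (forall u v, U (u, v) ->
    dot (d_u l u v) (b u v) = 0 /\ dot (d_v l u v) (b u v) = 0 /\
    dot (d_u l u v) (l u v) = 0 /\ dot (d_v l u v) (l u v) = 0) ->
  U (u0, v0) -> ~ (sffL z l u0 v0 = 0 /\ sffM z l u0 v0 = 0) ->
  0 <= coefE z u0 v0 * sffM z l u0 v0 - coefF z u0 v0 * sffL z l u0 v0 ->
  exists d X Y A B C D mu, 0 < d /\ (forall u v, square u0 v0 d (u, v) -> U (u, v)) /\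
    asymptotic_frame (square u0 v0 d) z X Y b l A B C D mu.
Proof.
  intros hU hz hb hl hE hnb hnl tr par h0 numb sgn.
  set (s := fun u v => sqrt (coefE z u v)); set (t := fun u v => sqrt (detI z u v)).
  set (a := fun u v => sffL z l u v / coefE z u v).
  set (c := fun u v => (coefE z u v * sffM z l u v - coefF z u v * sffL z l u v) / (coefE z u v * t u v)).
  set (rho := fun u v => sqrt (a u v * a u v + c u v * c u v)).
  assert (dz := smooth4_d_u U z hz); assert (dz' := smooth4_d_v U z hz).
  assert (sE : smooth U (coefE z)) by (apply smooth_dot; auto).
  assert (sF : smooth U (coefF z)) by (apply smooth_dot; auto).
  assert (sG : smooth U (coefG z)) by (apply smooth_dot; auto).
  assert (sI : smooth U (detI z)) by (unfold detI; apply smooth_minus; auto using smooth_mult).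
  assert (s0 : forall u v, U (u, v) -> 0 < s u v /\ s u v * s u v = coefE z u v).
  { intros u v h; destruct (hE u v h); split; [apply sqrt_lt_R0; auto|apply sqrt_sqrt; lra]. }
  assert (t0 : forall u v, U (u, v) -> 0 < t u v /\ t u v * t u v = detI z u v).
  { intros u v h; destruct (hE u v h); split; [apply sqrt_lt_R0; auto|apply sqrt_sqrt; lra]. }
  assert (ss : smooth U s) by (apply smooth_sqrt; auto; intros; apply hE; auto).
  assert (st : smooth U t) by (apply smooth_sqrt; auto; intros; apply hE; auto).
  assert (sL : smooth U (sffL z l)) by (apply smooth_dot; auto using smooth4_d_u).
  assert (sM : smooth U (sffM z l)) by (apply smooth_dot; auto using smooth4_d_u).
  assert (nE : forall u v, U (u, v) -> coefE z u v <> 0).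
  { intros u v h; destruct (hE u v h); lra. }
  assert (nt : forall u v, U (u, v) -> coefE z u v * t u v <> 0).
  { intros u v h; destruct (hE u v h), (t0 u v h); apply Rmult_integral_contrapositive_currified; lra. }
  assert (sa : smooth U a) by (apply smooth_div; auto).
  assert (sc : smooth U c) by (apply smooth_div; auto using smooth_minus, smooth_mult).
  assert (sq : smooth U (fun u v => a u v * a u v + c u v * c u v)) by auto using smooth_plus, smooth_mult.
  (* If [a] and [c] vanish, so do L and M. *)
  assert (pos0 : 0 < a u0 v0 * a u0 v0 + c u0 v0 * c u0 v0).
  { destruct (Req_dec (sffL z l u0 v0) 0) as [e|n].
    - assert (c u0 v0 <> 0); [|nra].
      assert (m : sffM z l u0 v0 <> 0) by tauto.
      unfold c; rewrite e, Rmult_0_r, Rminus_0_r.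
      unfold Rdiv; apply Rmult_integral_contrapositive_currified.
      + apply Rmult_integral_contrapositive_currified; auto.
      + apply Rinv_neq_0_compat; auto.
    - assert (a u0 v0 <> 0); [|nra].
      unfold a, Rdiv; apply Rmult_integral_contrapositive_currified; auto.
      apply Rinv_neq_0_compat; auto. }
  assert (c0 : 0 <= c u0 v0).
  { unfold c; apply Rmult_le_pos; auto; apply Rlt_le, Rinv_0_lt_compat.
    apply Rmult_lt_0_compat; [apply hE|apply t0]; auto. }
  destruct (open_locally_2d _ _ _ hU h0) as [d1 hd1].
  destruct (locally_2d_pos _ _ _ (smooth_cont _ _ _ _ sq h0) pos0) as [d2 hd2].
  assert (crho : continuity_2d_pt (fun u v => c u v + rho u v) u0 v0).
  { apply continuity_2d_pt_plus; [apply (smooth_cont U); auto|].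
    apply continuity_1d_2d_pt_comp; [apply continuity_pt_sqrt; lra|apply (smooth_cont U); auto]. }
  destruct (locally_2d_pos _ _ _ crho) as [d3 hd3].
  { apply Rplus_le_lt_0_compat; auto; apply sqrt_lt_R0; auto. }
  set (d := Rmin d1 (Rmin d2 d3)).
  set (S := square u0 v0 d).
  assert (hS : open S) by apply square_open.
  assert (dd : 0 < d) by (repeat apply Rmin_glb_lt; apply cond_pos).
  assert (l1 : d <= d1) by apply Rmin_l.
  assert (l2 : d <= d2) by (eapply Rle_trans; [apply Rmin_r|apply Rmin_l]).
  assert (l3 : d <= d3) by (eapply Rle_trans; [apply Rmin_r|apply Rmin_r]).
  assert (SU : forall u v, S (u, v) -> U (u, v)).
  { intros u v [i j]; simpl in i, j; apply hd1; lra. }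
  assert (Spos : forall u v, S (u, v) -> 0 < a u v * a u v + c u v * c u v).
  { intros u v [i j]; simpl in i, j; apply hd2; lra. }
  assert (Sc : forall u v, S (u, v) -> 0 < c u v + rho u v).
  { intros u v [i j]; simpl in i, j; apply hd3; lra. }
  assert (rho0 : forall u v, S (u, v) -> 0 < rho u v /\ rho u v * rho u v = a u v * a u v + c u v * c u v).
  { intros u v h; specialize (Spos u v h); split; [apply sqrt_lt_R0; auto|apply sqrt_sqrt; lra]. }
  assert (srho : smooth S rho).
  { apply smooth_sqrt; auto; apply (smooth_restrict U); auto. }
  set (k1 := fun u v => sqrt ((1 + c u v / rho u v) / 2)).
  set (k2 := fun u v => - a u v / rho u v / (2 * k1 u v)).
  assert (K := fun u v h => half_angle (a u v) (c u v) (rho u v) (proj1 (rho0 u v h)) (proj2 (rho0 u v h)) (Sc u v h)).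
  assert (res : forall k, smooth U k -> smooth S k) by (intros k; apply smooth_restrict; auto).
  assert (res4 : forall k, smooth4 U k -> smooth4 S k) by (intros k; apply smooth4_restrict; auto).
  assert (sk1 : smooth S k1).
  { apply smooth_sqrt; [auto| |intros u v h; apply (K u v h)].
    apply smooth_div; [auto| |apply smooth_const|intros; lra].
    apply smooth_plus; auto using smooth_const; apply smooth_div; auto.
    intros u v h; destruct (rho0 u v h); lra. }
  assert (sk2 : smooth S k2).
  { apply smooth_div; auto using smooth_const, smooth_mult.
    - apply smooth_div; auto using smooth_opp; intros u v h; destruct (rho0 u v h); lra.
    - intros u v h; destruct (K u v h) as [_ [p _]]; fold (k1 u v) in p; lra. }
  set (e1 := fun u v => scal4 (/ s u v) (d_u z u v)).
  set (e2 := fun u v => add4 (scal4 (- coefF z u v / (s u v * t u v)) (d_u z u v))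
                             (scal4 (coefE z u v / (s u v * t u v)) (d_v z u v))).
  assert (nst : forall u v, S (u, v) -> s u v * t u v <> 0).
  { intros u v h; destruct (s0 u v (SU u v h)), (t0 u v (SU u v h)).
    apply Rmult_integral_contrapositive_currified; lra. }
  assert (se1 : smooth4 S e1).
  { apply smooth4_scal; auto; apply smooth_inv; auto.
    intros u v h; destruct (s0 u v (SU u v h)); lra. }
  assert (se2 : smooth4 S e2).
  { apply smooth4_add; auto; apply smooth4_scal; auto; apply smooth_div; auto using smooth_opp, smooth_mult. }
  set (k := fun u v => coefF z u v / s u v); set (h := fun u v => t u v / s u v).
  assert (sk : smooth S k).
  { apply smooth_div; auto; intros u v i; destruct (s0 u v (SU u v i)); lra. }
  assert (sh : smooth S h).
  { apply smooth_div; auto; intros u v i; destruct (s0 u v (SU u v i)); lra. }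
  exists d, (fun u v => add4 (scal4 (k1 u v) (e1 u v)) (scal4 (k2 u v) (e2 u v))),
    (fun u v => add4 (scal4 (- k2 u v) (e1 u v)) (scal4 (k1 u v) (e2 u v))),
    (fun u v => s u v * k1 u v), (fun u v => k u v * k1 u v + h u v * k2 u v),
    (fun u v => - (s u v * k2 u v)), (fun u v => - (k u v * k2 u v) + h u v * k1 u v), rho.
  split; [auto|split; [auto|]]; fold S; split; [|split].
  - split; [|split; [|split]]; auto using smooth4_add, smooth4_scal, smooth_opp.
  - repeat apply conj; auto 6 using smooth_plus, smooth_mult, smooth_opp.
  - intros u v i.
    assert (iU := SU u v i).
    destruct (s0 u v iU) as [sp s2], (t0 u v iU) as [tp t2], (rho0 u v i) as [rp r2].
    destruct (K u v i) as [_ [k1p [kk [ka kc]]]].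
    fold (k1 u v) in k1p, kk, ka, kc; fold (k2 u v) in kk, ka, kc.
    destruct (hnb u v iU) as [[b1 b2] bb], (hnl u v iU) as [[n1 n2] [ll lb]].
    assert (sn : s u v <> 0) by lra; assert (tn : t u v <> 0) by lra.
    assert (En := nE u v iU).
    assert (ho : orthonormal (e1 u v) (e2 u v) (b u v) (l u v)).
    { apply (gram_schmidt _ _ _ _ _ _ (coefG z u v)); auto; rewrite dot_sym; auto. }
    assert (ez : d_u z u v = scal4 (s u v) (e1 u v)).
    { unfold e1; comps; field; lra. }
    assert (ez' : d_v z u v = add4 (scal4 (k u v) (e1 u v)) (scal4 (h u v) (e2 u v))).
    { unfold e1, e2, k, h; rewrite <- s2; comps; field; lra. }
    destruct (sff_as_derivative_of_normal U z l u v hU hz hl) as [wL [wM [wM' wN]]]; auto.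
    { intros; apply hnl; auto. }
    destruct (par u v iU) as [ub [vb [ul vl]]].
    destruct (weingarten_in_frame (e1 u v) (e2 u v) (b u v) (l u v) (d_u z u v) (d_v z u v)
      (d_u l u v) (d_v l u v) (s u v) (k u v) (h u v) (sffL z l u v) (sffM z l u v) (sffN z l u v)
      (a u v) (c u v)) as [elu elv]; auto; try lra.
    { unfold h; apply Rgt_not_eq, Rdiv_lt_0_compat; auto. }
    { unfold a; rewrite s2; field; auto. }
    { unfold a, c, k, h; field; auto. }
    { apply (Rmult_eq_reg_l (coefE z u v)); auto.
      replace (coefE z u v * sffN z l u v) with (2 * coefF z u v * sffM z l u v - coefG z u v * sffL z l u v)
        by (specialize (tr u v iU); lra).
      unfold a, c, k, h.
      transitivity (/ (s u v * s u v) * (2 * coefF z u v * coefE z u v * sffM z l u v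
         - (coefF z u v * coefF z u v + t u v * t u v) * sffL z l u v)).
      - rewrite t2, s2; unfold detI; field; auto.
      - field; auto. }
    split; [auto|split; [|split; [apply rotated_frame; auto|]]].
    { match goal with |- ?e <> 0 => replace e with (s u v * h u v * (k1 u v * k1 u v + k2 u v * k2 u v)) by ring end.
      rewrite kk, Rmult_1_r; apply Rgt_not_eq, Rmult_lt_0_compat; auto; apply Rdiv_lt_0_compat; auto. }
    rewrite elu, elv, ez, ez', <- ka, <- kc.
    assert (kk' : k2 u v * k2 u v = 1 - k1 u v * k1 u v) by lra.
    repeat split; comps; ring [kk'].
Qed.

Theorem theorem3p3 (U : R * R -> Prop) (z : R -> R -> E4)
    (hz : surface U z)
    (hpn : parallel_normalized_mean_curv U z)
    (hmu : mu_nonvanishing U z)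
    (u0 v0 : R) (h0 : U (u0, v0)) :
  exists (V W : R * R -> Prop) (f g p q : R -> R -> R),
    W (u0, v0) /\
    (forall u v, W (u, v) -> U (u, v)) /\
    diffeo V W f g p q /\
    canonical_parameters V (reparam z f g).
Proof.
  assert (hE := fun u v => immersion_det_pos U z u v hz).
  destruct hz as [hU [sz _]], hpn as [_ [b [sb [bb [bH bD]]]]].
  assert (nb : forall u v, U (u, v) -> is_normal_at z (b u v) u v /\ dot (b u v) (b u v) = 1).
  { intros u v h; split; auto; destruct (bH u v h) as [c [c0 e]], (hE u v h) as [_ dp].
    destruct (mean_curv_normal z u v) as [n1 n2]; [lra|].
    rewrite e in n1, n2; revert n1 n2; dots; intros n1 n2.
    split; apply (Rmult_eq_reg_l c); try apply Rgt_not_eq; lra. }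
  assert (frame : exists l, smooth4 U l /\ (forall u v, U (u, v) ->
    is_normal_at z (l u v) u v /\ dot (l u v) (l u v) = 1 /\ dot (l u v) (b u v) = 0) /\
    0 <= coefE z u0 v0 * sffM z l u0 v0 - coefF z u0 v0 * sffL z l u0 v0).
  { destruct (unit_binormal U z b) as [l [sl hl]]; auto; [intros; apply hE; auto|].
    destruct (Rle_lt_dec 0 (coefE z u0 v0 * sffM z l u0 v0 - coefF z u0 v0 * sffL z l u0 v0)) as [p|n].
    - exists l; auto.
    - exists (fun u v => scal4 (-1) (l u v)); split; [|split].
      + apply (smooth4_scal U (fun _ _ => -1)); auto using smooth_const.
      + intros u v h; destruct (hl u v h) as [[n1 n2] [ll lb]]; unfold is_normal_at; dots.
        rewrite n1, n2, ll, lb; repeat split; ring.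
      + revert n; unfold sffM, sffL; dots; lra. }
  destruct frame as [l [sl [nl sgn]]].
  assert (tr : forall u v, U (u, v) ->
    coefG z u v * sffL z l u v - 2 * coefF z u v * sffM z l u v + coefE z u v * sffN z l u v = 0).
  { intros u v h; destruct (nl u v h) as [n [_ lb]], (bH u v h) as [c [_ e]], (hE u v h) as [_ dp].
    assert (H := mean_curv_dot U z l u v hU sz h n); rewrite e in H; revert H; dots.
    rewrite dot_sym, lb, Rmult_0_r; intros H.
    apply (Rmult_eq_reg_l (1 / 2 * / detI z u v)); [lra|].
    apply Rmult_integral_contrapositive_currified; [lra|apply Rinv_neq_0_compat; lra]. }
  destruct (exists_asymptotic_frame U z b l u0 v0) as [d [X [Y [A [B [C [D [mu [d0 [SU fr]]]]]]]]]]; auto.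
  { intros u v h; apply (parallel_binormal U z); auto; intros s t i; destruct (hE s t i); lra. }
  { intros [eL eM].
    destruct (hE u0 v0 h0) as [E0 I0].
    assert (eN : sffN z l u0 v0 = 0).
    { specialize (tr u0 v0 h0); rewrite eL, eM in tr; apply (Rmult_eq_reg_l (coefE z u0 v0)); [|lra].
      rewrite Rmult_0_r, <- tr; ring. }
    set (s := sqrt (coefE z u0 v0)); set (t := sqrt (detI z u0 v0)).
    set (x := fun _ _ : R => (/ s, 0) : R * R).
    set (y := fun _ _ : R => (- coefF z u0 v0 / (s * t), coefE z u0 v0 / (s * t)) : R * R).
    destruct (nb u0 v0 h0) as [[n1 n2] b1], (nl u0 v0 h0) as [[m1 m2] [ll lb]].
    (* Where L = M = N = 0, any orthonormal frame contradicts the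
       hypothesis on [mu]; one with constant components in [z_u, z_v] is
       smooth on all of [U]. *)
    apply (hmu x y b l u0 v0); auto.
    - repeat (split; [apply smoothT_const|]); split; auto.
    - apply (geometric_frame_intro U); auto; try apply smoothT_const; try lra.
      + unfold push, x, y; simpl.
        replace (add4 (scal4 (/ s) _) _) with (scal4 (/ s) (d_u z u0 v0)) by (comps; ring).
        apply (gram_schmidt _ _ _ _ _ _ (coefG z u0 v0)); auto.
        * apply sqrt_lt_R0; auto.
        * apply sqrt_lt_R0; auto.
        * exact (sqrt_sqrt _ (Rlt_le _ _ E0)).
        * exact (sqrt_sqrt _ (Rlt_le _ _ I0)).
        * rewrite dot_sym; auto.
      + apply nb; auto.
      + apply nl; auto.
      + rewrite eL, eM, eN; ring.
      + rewrite eL, eM, eN; ring.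
    - unfold geom_mu; rewrite (nabla'_push_dot U); auto; [|apply smoothT_const|apply nl; auto].
      rewrite eL, eM, eN; ring. }
  destruct (canonical_of_asymptotic_frame u0 v0 d z X Y b l A B C D mu) as [V [W [f [g [p [q [W0 [WS res]]]]]]]]; auto.
  { apply (smooth4_restrict U); auto. }
  exists V, W, f, g, p, q; auto.
Qed.
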